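(* Let $(B_n)_{n\ge 0}$ be words on $\{0,s\}$ defined by $B_0=0$ and $B_{n+1}=B_n s^{a(n,0)}B_n s^{a(n,1)}\cdots B_n s^{a(n,q_n-1)}$ for $n\ge 0$ (with exactly $q_n$ copies of $B_n$), where $q_n\ge 1$ and $a(n,i)\ge 0$ are integers, and assume $|B_n|\to\infty$. Let $\omega\in\{0,s\}^{\mathbb N}$ be the one-sided infinite sequence that has every $B_n$ as an initial block. Let $X$, $T$, $x_s$ and the $k$-codings be those of the associated ordered Bratteli diagram, and let $x_{\min}\in X$ be the infinite path from the root that for all $n\geq 1$ follows the minimal edge entering $v(n,1)$. Suppose that $\omega$ is periodic, and let $P$ be the block of minimal length $|P|\ge 1$ such that $\omega=PPP\cdots$. Then: (1) There are $N\in\mathbb N$ and $a\ge 0$ such that for all $n\ge N$ we have $a(n,q_n-1)=0$ and $a(n,i)=a$ for all $i<q_n-1$. (2) For every $k\ge 1$ the $k$-coding of $x_{\min}$ by the first $k$ edges is periodic. (3) With its unique nonatomic invariant Borel probability measure, the system $(X,T)$ is measure-theoretically isomorphic to an odometer. (4) If $a=0$, the restriction of $T$ to $X\setminus\{x_s\}$ is topologically conjugate to an odometer.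
   Context: Associated ordered Bratteli diagram: level $0$ consists of a single vertex, the root; each level $n\ge 1$ has exactly two vertices, $v(n,1)$ and the spacer vertex $v(n,2)$. There is one edge from the root to $v(1,1)$ and one edge from the root to $v(1,2)$. For $n\ge 2$, $v(n,2)$ has exactly one incoming edge, with source $v(n-1,2)$. For $n\ge 0$, the edges entering $v(n+2,1)$ are totally ordered, and reading their sources in increasing order gives: $v(n+1,1)$, then $a(n,0)$ edges from $v(n+1,2)$, then one edge from $v(n+1,1)$, then $a(n,1)$ edges from $v(n+1,2)$, and so on, ending with the $q_n$-th edge from $v(n+1,1)$ followed by $a(n,q_n-1)$ edges from $v(n+1,2)$. Thus $B_n$ is the block attached to the vertex $v(n+1,1)$. $X$ is the space of infinite directed paths $x=x_0x_1x_2\cdots$ starting at the root ($x_i$ is an edge from level $i$ to level $i+1$), with the topology generated by cylinder sets. An edge is minimal (maximal) if it is the first (last) among the edges with the same terminal vertex; a path is minimal (maximal) if all its edges are. The adic (Vershik) transformation $T$ is defined on non-maximal paths: if $i$ is the least index such that $x_i$ is not maximal, $Tx$ is obtained by replacing $x_i$ by its successor $y_i$ in the order on edges with the same terminal vertex, and replacing $x_0\cdots x_{i-1}$ by the segment consisting of minimal edges from the root to the source of $y_i$. The path $x_s$ is the unique path passing through $v(n,2)$ for all $n\ge1$, and one sets $T(x_s)=x_s$. In part (4), $T$ on $X\setminus\{x_s\}$ is understood to be extended so as to send the (unique) maximal path other than $x_s$ to $x_{\min}$. For $k\ge1$, let $A_k$ be the finite set of path segments from the root to vertices of level $k$, considered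 as an alphabet, and let $\alpha_k(x)\in A_k$ be the initial segment of $k$ edges of $x$. The $k$-coding of $x$ is $\phi_k(x)=\alpha_k(x)\alpha_k(Tx)\alpha_k(T^2x)\cdots$. A one-sided sequence is periodic if it equals $PPP\cdots$ for some finite nonempty word $P$. An odometer is the translation by $1$ on an inverse limit of finite cyclic groups $\mathbb Z/m_i\mathbb Z$ with $m_i\mid m_{i+1}$, $m_i\to\infty$ (with Haar measure when considered as a measure-preserving system). *)

(* Defs.v *)
From HB Require Import structures.
From mathcomp Require Import all_boot all_order all_algebra.
From mathcomp Require Import all_classical all_reals all_analysis.

Set Implicit Arguments.
Unset Strict Implicit.
Unset Printing Implicit Defensive.

Import Order.TTheory GRing.Theory Num.Theory.

Local Open Scope classical_set_scope.

(* The alphabet {0, s}. *)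
Inductive letter := Zero | Spacer.

Fixpoint block (q : nat -> nat) (a : nat -> nat -> nat) (n : nat)
    : seq letter :=
  if n is m.+1 then
    flatten [seq block q a m ++ nseq (a m i) Spacer | i <- iota 0 (q m)]
  else [:: Zero].

Definition repeats (S : Type) (P : seq S) (w : nat -> S) : Prop :=
  0 < size P /\ forall j, w j = nth (w 0) P (j %% size P).

Definition is_periodic (S : Type) (w : nat -> S) : Prop :=
  exists P, repeats P w.

(* [Root] is the only vertex of level 0; at every level n >= 1, [Tower] is
   v(n,1) and [SpacerVertex] is v(n,2). *)
Inductive vertex := Root | Tower | SpacerVertex.

(* An edge from level i to level i+1 is a pair (terminal vertex, rank), where
   the rank is the position, counted from 0, in the order on the edges with the
   same terminal vertex; the level i is implicit. *)
Definition edge := (vertex * nat)%type.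

Section diagram.
Variables (q : nat -> nat) (a : nat -> nat -> nat).

(* The sources, in increasing order, of the edges from level i to the vertex v
   of level i+1. *)
Definition sources (i : nat) (v : vertex) : seq vertex :=
  match v, i with
  | Root, _ => [::]
  | _, 0 => [:: Root]
  | SpacerVertex, _.+1 => [:: SpacerVertex]
  | Tower, n.+1 =>
      flatten [seq Tower :: nseq (a n j) SpacerVertex | j <- iota 0 (q n)]
  end.

Definition is_edge (i : nat) (e : edge) : bool := e.2 < size (sources i e.1).

Definition source (i : nat) (e : edge) : vertex :=
  nth Root (sources i e.1) e.2.

Definition min_edge (e : edge) : bool := e.2 == 0.

Definition max_edge (i : nat) (e : edge) : bool :=
  e.2.+1 == size (sources i e.1).

Definition next_edge (e : edge) : edge := (e.1, e.2.+1).

Definition is_path (x : nat -> edge) : Prop :=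
  forall i, is_edge i (x i) /\
    source i (x i) = if i is j.+1 then (x j).1 else Root.

(* The space X. *)
Record path_space := PathSpace {
  path_edge :> nat -> edge;
  path_edgeP : is_path path_edge }.

HB.instance Definition _ := gen_eqMixin path_space.
HB.instance Definition _ := gen_choiceMixin path_space.

Lemma spacer_pathP : is_path (fun=> (SpacerVertex, 0)).
Proof. by case. Qed.

Definition x_s : path_space := PathSpace spacer_pathP.

HB.instance Definition _ := isPointed.Build path_space x_s.

Lemma min_pathP (q_gt0 : forall n, 0 < q n) : is_path (fun=> (Tower, 0)).
Proof.
case=> [|i]; first by [].
by rewrite /is_edge /source /=; case: (q i) (q_gt0 i).
Qed.

Definition x_min (q_gt0 : forall n, 0 < q n) : path_space :=
  PathSpace (min_pathP q_gt0).

(* The initial segment alpha_k(x), a letter of the alphabet A_k. *)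
Definition alpha (k : nat) (x : path_space) : seq edge := mkseq x k.

Definition cylinder (p : path_space * nat) : set path_space :=
  [set y | alpha p.2 y = alpha p.2 p.1].

HB.instance Definition _ :=
  @isSubBaseTopological.Build path_space (path_space * nat)%type setT cylinder.

(* [adic_step x y]: x is not maximal and y is its image under the adic
   transformation. Since y is a path, its first i edges are then the minimal
   segment from the root to the source of [y i]. *)
Definition adic_step (x y : path_space) : Prop :=
  exists i, [/\ (forall j, j < i -> max_edge j (x j)), ~~ max_edge i (x i),
    y i = next_edge (x i), (forall j, j < i -> min_edge (y j)) &
    (forall j, i < j -> y j = x j)].

(* [None] encodes "undefined": T is defined on x_s and the non-maximal paths. *)
Definition adic (x : path_space) : option path_space :=
  xget None
    [set Some y | y in [set y | adic_step x y \/ (x = x_s /\ y = x_s)]].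

(* T, extended by sending every maximal path other than x_s to x_min. *)
Definition adic_ext (q_gt0 : forall n, 0 < q n) (x : path_space) : path_space :=
  odflt (x_min q_gt0) (adic x).

(* c is the k-coding of x; this includes that every T^j x is defined. *)
Definition is_coding (k : nat) (x : path_space) (c : nat -> seq edge) : Prop :=
  exists z : nat -> path_space,
    [/\ z 0 = x, forall j, adic (z j) = Some (z j.+1) &
        forall j, c j = alpha k (z j)].

End diagram.

Notation borel T := (g_sigma_algebraType (@open T)).

Section measure_preserving.
Variable R : realType.

Definition atom d (X : measurableType d) (mu : probability X R) (A : set X)
    : Prop :=
  [/\ measurable A, (0 < mu A)%E &
    forall B, measurable B -> B `<=` A -> mu B = 0%E \/ mu B = mu A].

Definition nonatomic d (X : measurableType d) (mu : probability X R) : Prop :=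
  forall A, ~ atom mu A.

Definition invariant_measure d (X : measurableType d) (mu : probability X R)
    (T : X -> option X) : Prop :=
  forall A, measurable A ->
    let TA := [set x | exists2 y, T x = Some y & A y] in
    measurable TA /\ mu TA = mu A.

(* Isomorphism modulo null sets of (X, mu, T), with T possibly undefined on a
   null set, and (Y, nu, S). *)
Definition measure_isomorphic d (X : measurableType d) (mu : probability X R)
    (T : X -> option X) d' (Y : measurableType d') (nu : probability Y R)
    (S : Y -> Y) : Prop :=
  exists (X0 : set X) (Y0 : set Y) (f : X -> Y) (g : Y -> X),
  [/\ [/\ measurable X0, measurable Y0, mu (~` X0) = 0%E & nu (~` Y0) = 0%E],
      [/\ forall x, X0 x -> Y0 (f x) /\ g (f x) = x &
          forall y, Y0 y -> X0 (g y) /\ f (g y) = y],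
      [/\ measurable_fun X0 f & measurable_fun Y0 g],
      forall A, measurable A -> mu (X0 `&` f @^-1` A) = nu A &
      forall x, X0 x -> exists y, [/\ T x = Some y, X0 y & f y = S (f x)]].

End measure_preserving.

Record odometer_base := OdometerBase {
  modulus :> nat -> nat;
  modulus_gt0 : forall i, 0 < modulus i;
  modulus_dvd : forall i, modulus i %| modulus i.+1;
  modulus_oo : modulus @ \oo --> \oo }.

(* The inverse limit of the groups Z/m_i, with the elements of Z/m_i
   represented by the residues 0, ..., m_i - 1. *)
Record odometer (m : odometer_base) := Odometer {
  residue :> nat -> nat;
  residueP : forall i, residue i < m i /\ residue i.+1 %% m i = residue i }.

Section odometer_group.
Variable m : odometer_base.
Implicit Types z w : odometer m.

HB.instance Definition _ := gen_eqMixin (odometer m).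
HB.instance Definition _ := gen_choiceMixin (odometer m).

Lemma odometer_ext z w : (forall i, z i = w i) -> z = w.
Proof.
case: z w => [z zP] [w wP] /= /funext zw; rewrite -{}zw in wP *.
by congr Odometer; exact: Prop_irrelevance.
Qed.

Lemma of_seqP (u : nat -> nat) : (forall i, u i.+1 = u i %[mod m i]) ->
  forall i, u i %% m i < m i /\ (u i.+1 %% m i.+1) %% m i = u i %% m i.
Proof.
move=> uP i; split; first by rewrite ltn_pmod // modulus_gt0.
by rewrite modn_dvdm ?modulus_dvd.
Qed.

Definition of_seq u (uP : forall i, u i.+1 = u i %[mod m i]) : odometer m :=
  Odometer (of_seqP uP).

Lemma residue_mod z i : z i.+1 = z i %[mod m i].
Proof. by have [_ <-] := residueP z i; rewrite modn_mod. Qed.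

Lemma residue_small z i : z i %% m i = z i.
Proof. by have [zi _] := residueP z i; rewrite modn_small. Qed.

Lemma addP z w i : z i.+1 + w i.+1 = z i + w i %[mod m i].
Proof. by rewrite -modnDm !residue_mod modnDm. Qed.

Lemma oppP z i : m i.+1 - z i.+1 = m i - z i %[mod m i].
Proof.
have [zi _] := residueP z i; have [zi1 _] := residueP z i.+1.
apply/eqP; rewrite -(eqn_modDr (z i)) subnK; last exact: ltnW.
rewrite -modnDmr -residue_mod modnDmr subnK; last exact: ltnW.
by rewrite modnn; exact: modulus_dvd.
Qed.

Definition odometer0 : odometer m := @of_seq (fun=> 0) (fun=> erefl).
Definition odometer_add z w : odometer m := of_seq (addP z w).
Definition odometer_opp z : odometer m := of_seq (oppP z).

Lemma odometer_addA : associative odometer_add.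
Proof. by move=> x y z; apply: odometer_ext => i /=; rewrite modnDmr modnDml addnA. Qed.

Lemma odometer_addC : commutative odometer_add.
Proof. by move=> x y; apply: odometer_ext => i /=; rewrite addnC. Qed.

Lemma odometer_add0 : left_id odometer0 odometer_add.
Proof. by move=> x; apply: odometer_ext => i /=; rewrite modnDml residue_small. Qed.

Lemma odometer_addN : left_inverse odometer0 odometer_opp odometer_add.
Proof.
move=> x; apply: odometer_ext => i /=; have [xi _] := residueP x i.
by rewrite modnDml subnK ?modnn ?mod0n// ltnW.
Qed.

HB.instance Definition _ := GRing.isZmodule.Build (odometer m)
  odometer_addA odometer_addC odometer_add0 odometer_addN.

HB.instance Definition _ := isPointed.Build (odometer m) odometer0.

(* The topology induced by the product of the discrete spaces Z/m_i. *)
HB.instance Definition _ :=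
  @isSubBaseTopological.Build (odometer m) (nat * nat)%type setT
    (fun p => [set z | z p.1 = p.2]).

(* The translation by 1, i.e. by the element (1 mod m_i)_i. *)
Definition odometer1 : odometer m := @of_seq (fun=> 1) (fun=> erefl).

Definition odometer_map z : odometer m := (z + odometer1)%R.

Definition is_haar (R : realType) (nu : probability (borel (odometer m)) R)
    : Prop :=
  forall w (A : set (borel (odometer m))), measurable A ->
    nu [set (w + z)%R | z in A] = nu A.

End odometer_group.

(* Topological conjugacy between the restriction to the subspace A of X
   of T : X -> X (which must map A to A) and S : Y -> Y. *)
Definition conjugate_on (X : topologicalType) (A : set X) (T : X -> X)
    (Y : topologicalType) (S : Y -> Y) : Prop :=
  exists (h : A -> Y) (g : Y -> A),
  [/\ continuous h, continuous g, cancel h g, cancel g h &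
      forall x : A, exists2 y : A, set_val y = T (set_val x) & h y = S (h x)].

(* Main.v *)
(* For large n, an occurrence of B_n in omega = PPP... can only start at a
   multiple of |P|. Hence every run of spacers between two consecutive copies of
   B_n inside B_{n+1} has the same length c_n, the distance from |B_n| to the
   next multiple of |P|; a trailing run of length t gives c_{n+1} = c_n - t, so
   c_n is eventually a constant a and the trailing runs vanish. From then on
   B_{n+1} s^a is a power of B_n s^a, so the lengths H_n = |B_n| + a divide each
   other. A point y of the odometer with moduli H_n determines a path: at level
   n+1 it is at the position y_n of B_n if y_n < |B_n|, and at the spacer vertex
   otherwise. This map is continuous, sends to x_s the a points that are in the
   spacers at all levels, is injective elsewhere, and conjugates the translation
   by 1 to T outside the countable backward orbit of 0. Nonatomic measures do not
   charge countable sets, so the Haar measure corresponds to the unique nonatomic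
   T-invariant probability measure. *)
From HB Require Import structures.
Require Import Defs.
From mathcomp Require Import all_boot all_order all_algebra.
From mathcomp Require Import finmap all_classical all_reals all_analysis.
From mathcomp Require Import zify.

Set Implicit Arguments.
Unset Strict Implicit.
Unset Printing Implicit Defensive.

Import Order.TTheory GRing.Theory Num.Theory.

Local Open Scope classical_set_scope.

(** * Spacers in a periodic word *)

Lemma nonincreasing_eventually_constant (u : nat -> nat) :
  (forall n, u n.+1 <= u n) -> exists N, forall n, N <= n -> u n = u N.
Proof.
move=> u_dec.
have u_le m n : m <= n -> u n <= u m.
  move=> /subnKC <-; elim: (n - m) => [|k IH]; first by rewrite addn0.
  by rewrite addnS (leq_trans (u_dec _)).
pose is_value : pred nat := fun v => `[<exists n, u n = v>].
have ex : exists v, is_value v by exists (u 0); apply/asboolP; exists 0.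
have [_ /asboolP[N <-] vmin] := ex_minnP ex.
exists N => n leNn; apply/eqP; rewrite eqn_leq u_le //= vmin //.
by apply/asboolP; exists n.
Qed.

Lemma dvdn_add_neg x d : 0 < d -> d %| x + (d - x %% d) %% d.
Proof.
move=> d_gt0; rewrite /dvdn modnDmr -modnDml subnKC ?modnn //.
by rewrite ltnW // ltn_pmod.
Qed.

Section block_words.
Variables (q : nat -> nat) (a : nat -> nat -> nat).

(** The position in [B_{n+1}] at which its copy of [B_n] of index [i] starts; for [i = q n] it is
    the length of [B_{n+1}]. *)
Definition block_offset n i := \sum_(j < i) (size (block q a n) + a n j).

Lemma block_offsetS n i : block_offset n i.+1 =
  block_offset n i + (size (block q a n) + a n i).
Proof. by rewrite /block_offset big_ord_recr. Qed.

Lemma size_blockS n : size (block q a n.+1) = block_offset n (q n).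
Proof.
rewrite /= size_flatten /shape -map_comp sumnE big_map /block_offset.
rewrite -{1}(subn0 (q n)) -/(index_iota 0 (q n)) big_mkord.
by apply: eq_bigr => j _; rewrite /= size_cat size_nseq.
Qed.

Lemma nth_flatten_prefix (T : Type) (d : T) (f : nat -> seq T) (k i j : nat) :
  i < k -> j < size (f i) ->
  nth d (flatten [seq f x | x <- iota 0 k]) (\sum_(x < i) size (f x) + j)
  = nth d (f i) j.
Proof.
elim: k f i => // k IH f [|i] ik ji; rewrite /= nth_cat.
  by rewrite big_ord0 add0n ji.
rewrite big_ord_recl /= -addnA ltnNge leq_addr /= addKn -[1]/(1 + 0).
by rewrite iotaDl -map_comp -(IH (fun x => f x.+1)).
Qed.

Lemma nth_blockS n i j d : i < q n -> j < size (block q a n) + a n i ->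
  nth d (block q a n.+1) (block_offset n i + j) =
  if j < size (block q a n) then nth d (block q a n) j else Spacer.
Proof.
move=> iq ji.
have -> : block_offset n i =
    \sum_(x < i) size (block q a n ++ nseq (a n x) Spacer).
  by apply: eq_bigr => x _; rewrite size_cat size_nseq.
rewrite /= nth_flatten_prefix // ?size_cat ?size_nseq //.
by rewrite nth_cat; case: ltnP => // hj; rewrite nth_nseq ifT //; lia.
Qed.

Lemma leq_block_offset n i j : i <= j -> block_offset n i <= block_offset n j.
Proof.
move=> /subnKC <-; elim: (j - i) => [|k IH]; first by rewrite addn0.
by rewrite addnS block_offsetS (leq_trans IH) ?leq_addr.
Qed.

Lemma periodic_spacers (q_gt0 : forall n, 0 < q n)
    (block_oo : (fun n => size (block q a n)) @ \oo --> \oo)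
    (omega : nat -> letter)
    (omegaP : forall n, mkseq omega (size (block q a n)) = block q a n)
    (P : seq letter) (omega_P : repeats P omega)
    (P_min : forall P' : seq letter, repeats P' omega -> size P <= size P') :
  exists N a0 : nat, forall n, N <= n ->
    a n (q n).-1 = 0 /\ forall i, i < (q n).-1 -> a n i = a0.
Proof.
pose h n := size (block q a n); pose p := size P.
have [p_gt0 omega_nth] := omega_P; rewrite -/p in p_gt0 omega_nth.
have omega_modp j : omega (j %% p) = omega j.
  by rewrite omega_nth modn_mod -omega_nth.
have omega_cong i j : i = j %[mod p] -> omega i = omega j.
  by move=> ij; rewrite -omega_modp ij omega_modp.
have omega_block n j d : j < h n -> omega j = nth d (block q a n) j.
  by move=> jh; rewrite -omegaP nth_mkseq.
have omega0 : omega 0 = Zero by rewrite (@omega_block 0 0 Zero).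
(* If the shift by [t] fixes [omega], then so does the shift by [t %% p]; a nonzero remainder would
   be a period shorter than the minimal one. *)
have period t : (forall j, omega (t + j) = omega j) -> p %| t.
  move=> tP; rewrite /dvdn; apply/negPn/negP => t0.
  have rP j : omega (t %% p + j) = omega j.
    by rewrite -(tP j); apply: omega_cong; rewrite modnDml.
  suff : repeats (mkseq omega (t %% p)) omega.
    by move=> /P_min; rewrite size_mkseq leqNgt ltn_pmod.
  rewrite /repeats size_mkseq lt0n; split=> // j.
  rewrite nth_mkseq ?ltn_pmod ?lt0n // {1}(divn_eq j (t %% p)).
  elim: (j %/ _) => [|k IH]; first by rewrite mul0n add0n.
  by rewrite mulSn -addnA rP.
(* A block of length at least [p] shows a whole period, so wherever it recurs the shift fixes all of
   [omega]. *)
have occ n t : p <= h n -> (forall j, j < h n -> omega (t + j) = omega j) ->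
    p %| t.
  move=> ph tP; apply: period => j; rewrite -(omega_modp j) -(tP (j %% p)).
    by apply: omega_cong; rewrite modnDmr.
  by rewrite (leq_trans _ ph) ?ltn_pmod.
have inS n i j : i < q n -> j < h n + a n i ->
    omega (block_offset n i + j) = if j < h n then omega j else Spacer.
  move=> iq jh; rewrite (@omega_block n.+1 _ Zero); last first.
    rewrite /h size_blockS; apply: leq_trans (leq_block_offset _ iq).
    by rewrite block_offsetS ltn_add2l.
  by rewrite nth_blockS //; case: ltnP => // jhn; rewrite -omega_block.
have [n0 n0P] : exists n0, forall n, n0 <= n -> p <= h n.
  have /cvgnyPge/(_ p)[n0 _ n0P] := block_oo.
  by exists n0 => n /n0P.
pose c n := (p - h n %% p) %% p.
have cP n : p %| h n + c n.
  exact: dvdn_add_neg.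
have c_lt n : c n < p by rewrite ltn_pmod.
have off_dvd n i : n0 <= n -> i < q n -> p %| block_offset n i.
  move=> /n0P pn iq; apply: (occ n) => // j jh; rewrite inS ?jh //.
  exact: leq_trans jh (leq_addr _ _).
(* A longer run of spacers would cover a multiple of [p], where [omega] reads [omega 0 = Zero]. *)
have a_le n i : n0 <= n -> i < q n -> a n i <= c n.
  move=> nn iq; rewrite leqNgt; apply/negP => ca.
  have := inS n i (h n + c n) iq; rewrite ltn_add2l => /(_ ca).
  rewrite ltnNge leq_addr /= (omega_cong _ 0) ?omega0 //.
  by apply/eqP; rewrite mod0n; exact: dvdn_add (off_dvd _ _ nn iq) (cP n).
(* The next copy of [B_n] also starts at a multiple of [p], so [c n - a n i] is a multiple of [p]
   smaller than [p]. *)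
have a_eq n i : n0 <= n -> i.+1 < q n -> a n i = c n.
  move=> nn iq; have iq' : i < q n := ltnW iq.
  have : p %| h n + a n i.
    by have := off_dvd _ _ nn iq; rewrite block_offsetS dvdn_addr ?off_dvd.
  have := cP n; have := a_le _ _ nn iq'; have := c_lt n => cp ac p1 p2.
  have : p %| c n - a n i.
    by rewrite -(subnDl (h n)) dvdn_sub.
  by move=> /dvdn_leq; case: posnP => [|_ /(_ isT)]; lia.
(* Modulo [p], the length of [B_{n+1}] is that of its last [B_n] together with the trailing run. *)
have cS n : n0 <= n -> c n.+1 = c n - a n (q n).-1.
  move=> nn; have q1 : (q n).-1 < q n by rewrite ltn_predL.
  have ac := a_le _ _ nn q1; have := c_lt n => cp.
  have hS : h n.+1 = block_offset n (q n).-1 + (h n + a n (q n).-1).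
    by rewrite /h size_blockS -block_offsetS prednK.
  have := cP n.+1; rewrite hS -addnA dvdn_addr ?off_dvd // => d1.
  have d2 := cP n; have cp1 := c_lt n.+1.
  have /eqP : h n + a n (q n).-1 + c n.+1 = h n + c n %[mod p].
    by rewrite (eqP d1) (eqP d2).
  have -> : h n + c n = h n + a n (q n).-1 + (c n - a n (q n).-1) by lia.
  by rewrite eqn_modDl !modn_small; [move/eqP|lia|].
have [|M MP] := @nonincreasing_eventually_constant (fun k => c (n0 + k)).
  by move=> k; rewrite addnS cS ?leq_addr ?leq_subr.
(* Once [c] is constant, [cS] leaves no room for a trailing run. *)
exists (n0 + M), (c (n0 + M)) => n nM.
have nn : n0 <= n by lia.
have cn : c n = c (n0 + M).
  by have := MP (n - n0); rewrite subnKC // => ->//; lia.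
have cn1 : c n.+1 = c (n0 + M).
  have := MP (n.+1 - n0); rewrite subnKC // => [->//|]; lia.
split=> [|i iq]; last by rewrite a_eq //; have := q_gt0 n; lia.
have := a_le n (q n).-1 nn; rewrite ltn_predL q_gt0 => /(_ isT).
by have := cS _ nn; lia.
Qed.

End block_words.

(** * Paths as sequences of states *)

Section path_states.
Variables (q : nat -> nat) (a : nat -> nat -> nat).
Hypothesis q_gt0 : forall n, 0 < q n.

Definition is_vertex k v :=
  match k, v with 0, Root | _.+1, Tower | _.+1, SpacerVertex => true
  | _, _ => false end.

(* The number of paths from the root to the vertex v of level k. *)
Definition weight k v := if v is Tower then size (block q a k.-1) else 1.

Definition weights k v := map (weight k) (sources q a k v).

Lemma block_gt0 n : 0 < size (block q a n).
Proof.
elim: n => // n IH; rewrite size_blockS -(prednK (q_gt0 n)).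
by rewrite block_offsetS addn_gt0 addn_gt0 IH orbT.
Qed.

Lemma weight_gt0 k v : 0 < weight k v.
Proof. by case: v => //; exact: block_gt0. Qed.

Lemma sumn_weights k v : is_vertex k.+1 v -> sumn (weights k v) = weight k.+1 v.
Proof.
case: k v => [|n] [] // _.
rewrite /weights map_flatten sumn_flatten -!map_comp /= size_flatten /shape.
congr sumn; rewrite -map_comp; apply: eq_map => j /=.
by rewrite map_nseq sumn_nseq mul1n size_cat size_nseq.
Qed.

(* States: a vertex together with the rank, in the order induced by the order
   on edges, of a path from the root to it. *)
Fixpoint rank (x : nat -> edge) k : nat :=
  if k is j.+1 then flatten_index (weights j (x j).1) (x j).2 (rank x j) else 0.

Definition vertex_at (x : nat -> edge) k := if k is j.+1 then (x j).1 else Root.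

Definition state (x : nat -> edge) k := (vertex_at x k, rank x k).

(** Computes the state at level [k] from the state at level [k.+1]: the rank there tells which
    incoming edge comes last and which segment precedes it. *)
Definition descend k (s : vertex * nat) : vertex * nat :=
  (nth Root (sources q a k s.1) (reshape_index (weights k s.1) s.2),
   reshape_offset (weights k s.1) s.2).

Definition is_state k (s : vertex * nat) : bool :=
  is_vertex k s.1 && (s.2 < weight k s.1).

Lemma sources_vertex k v i : i < size (sources q a k v) ->
  is_vertex k.+1 v /\ is_vertex k (nth Root (sources q a k v) i).
Proof.
case: k v => [|k] [] //; [by case: i|by case: i| |by case: i].
move=> ilt; split=> //.
apply: (all_nthP Root _ i ilt); rewrite /sources.
by elim: (iota _ _) => //= j s IH; rewrite all_cat IH andbT all_nseq orbT.
Qed.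

Lemma is_state_rank (x : path_space q a) k : is_state k (state x k).
Proof.
elim: k => // k /andP[_ IH]; have [ek sk] := path_edgeP x k.
have [v1 _] := sources_vertex ek; rewrite /is_state v1 /=.
rewrite -sumn_weights //; apply: flatten_indexP.
rewrite (nth_map Root) // -/(source q a k (x k)) sk.
by move: IH; rewrite /state /=; case: (k).
Qed.

Lemma rank_lt (x : path_space q a) k :
  rank x k < nth 0 (weights k (x k).1) (x k).2.
Proof.
have /andP[_ +] := is_state_rank x k; have [ek sk] := path_edgeP x k.
rewrite (nth_map Root) // -/(source q a k (x k)) sk.
by rewrite /state /=; case: (k).
Qed.

Lemma descend_state (x : path_space q a) k :
  descend k (state x k.+1) = state x k.
Proof.
have lt := rank_lt x k; have [_ sk] := path_edgeP x k.
rewrite /descend /= flatten_indexKl // flatten_indexKr //.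
by rewrite -/(source q a k (x k)) sk; case: (k).
Qed.

Definition state_edge k (s : vertex * nat) : edge :=
  (s.1, reshape_index (weights k s.1) s.2).

Lemma edge_state (x : path_space q a) k : x k = state_edge k (state x k.+1).
Proof.
by rewrite /state_edge /= flatten_indexKl ?rank_lt //; case: (x k).
Qed.

Lemma state_down (x y : path_space q a) j k : j <= k ->
  state x k = state y k -> state x j = state y j.
Proof.
move=> /subnKC <-; elim: (k - j) => [|i IH]; first by rewrite addn0.
rewrite addnS => eqs; apply: IH.
by rewrite -(descend_state x) -(descend_state y) eqs.
Qed.

Lemma path_ext (x y : path_space q a) : (forall k, x k = y k) -> x = y.
Proof.
case: x y => x xP [y yP] /= /funext xy; rewrite -{}xy in yP *.
by congr PathSpace; exact: Prop_irrelevance.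
Qed.

(** Agreement at arbitrarily high levels is enough, since a state determines all lower ones and the
    edges below it. *)
Lemma state_inj (x y : path_space q a) :
  (forall k, exists2 j, k <= j & state x j = state y j) -> x = y.
Proof.
move=> xy; apply: path_ext => k; have [j kj xyj] := xy k.+1.
by rewrite !edge_state (state_down kj xyj).
Qed.

(** Trades an initial segment for a single state, so that cylinders become conditions on one
    state. *)
Lemma state_alpha (x y : path_space q a) k :
  alpha k x = alpha k y <-> state x k = state y k.
Proof.
split=> xy.
  have {xy} : forall i, i < k -> x i = y i.
    move=> i ik; have /(congr1 (nth (Root, 0) ^~ i)) := xy.
    by rewrite !nth_mkseq.
  elim: k => // k IH xy; rewrite /state /= xy //.
  have /(congr1 snd) /= -> // : state x k = state y k.
  by apply: IH => i /ltnW; exact: xy.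
apply/(@eq_from_nth _ (Root, 0)); rewrite ?size_mkseq // => i ik.
by rewrite !nth_mkseq // !edge_state (state_down ik xy).
Qed.

Lemma is_state_descend k s : is_state k.+1 s -> is_state k (descend k s).
Proof.
move=> /andP[v1 p1]; rewrite -sumn_weights // in p1.
have := reshape_indexP p1; have := reshape_offsetP p1.
rewrite size_map => lt1 lt2.
have [_ v] := sources_vertex lt2; rewrite /is_state v /=.
by rewrite (nth_map Root) in lt1.
Qed.

Lemma state_pathP (S : nat -> vertex * nat) :
  (forall k, is_state k (S k)) -> (forall k, descend k (S k.+1) = S k) ->
  is_path q a (fun k => state_edge k (S k.+1)).
Proof.
move=> Sst Sd k; have /andP[v1 p1] := Sst k.+1.
have idx : reshape_index (weights k (S k.+1).1) (S k.+1).2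
    < size (sources q a k (S k.+1).1).
  rewrite -(size_map (weight k)); apply: reshape_indexP.
  by rewrite -/(weights _ _) sumn_weights.
split=> //; rewrite /source /=; have := Sd k; rewrite /descend.
case: k {p1 idx v1} => [|k] /(congr1 fst) /= ->//.
by have /andP[] := Sst 0; case: (S 0).1.
Qed.

(** Together with [state_inj], this presents the path space as the inverse limit of the sets of
    states under [descend]. *)
Lemma exists_path (S : nat -> vertex * nat) :
  (forall k, is_state k (S k)) -> (forall k, descend k (S k.+1) = S k) ->
  exists x : path_space q a, forall k, state x k = S k.
Proof.
move=> Sst Sd; exists (PathSpace (state_pathP Sst Sd)); elim=> [|k IH].
  by have /andP[] := Sst 0; case: (S 0) => -[] // [].
rewrite /state /=; case E : (S k.+1) => [v p] /=; congr pair.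
have := Sd k; rewrite -IH E /descend => /(congr1 snd) /= <-.
exact: reshape_indexK.
Qed.

Lemma flatten_index_last (sh : seq nat) r c : all (leq 1) sh ->
  r < size sh -> c < nth 0 sh r ->
  (flatten_index sh r c).+1 = sumn sh <-> r.+1 = size sh /\ c.+1 = nth 0 sh r.
Proof.
move=> sh_gt0 rsz cr.
have : all (leq 1) (drop r.+1 sh).
  by apply/allP => z /mem_drop; exact: (allP sh_gt0).
have -> : sumn sh = sumn (take r sh) + (nth 0 sh r + sumn (drop r.+1 sh)).
  by rewrite -{1}(cat_take_drop r sh) sumn_cat (drop_nth 0).
have := size_drop r.+1 sh; rewrite /flatten_index.
by case: (drop r.+1 sh) => [|z s] /= sz; [split; lia|case/andP; split; lia].
Qed.

(** Ranks are lexicographic with the top edge most significant, and all weights are positive: the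
    last rank requires the last top edge and, below it, the last rank again. *)
Lemma rank_max (x : path_space q a) k :
  (forall j, j < k -> max_edge q a j (x j)) <->
  (rank x k).+1 = weight k (vertex_at x k).
Proof.
elim: k => [|k IH]; first by split.
have [ek sk] := path_edgeP x k; have [v1 _] := sources_vertex ek.
have sz : size (weights k (x k).1) = size (sources q a k (x k).1).
  by rewrite size_map.
have nthw : nth 0 (weights k (x k).1) (x k).2 = weight k (vertex_at x k).
  rewrite (nth_map Root) // -/(source q a k (x k)) sk; by case: (k).
have := @flatten_index_last (weights k (x k).1) (x k).2 (rank x k).
rewrite all_map sumn_weights // sz nthw => /= /(_ _ ek) [].
- by elim: sources => //= v s ->; rewrite weight_gt0.
- by rewrite -nthw; exact: rank_lt.
move=> last_max max_last; split=> [xmax|/last_max[/eqP xk /IH xmax] j].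
  apply: max_last; split; last by apply/IH => j /ltnW; exact: xmax.
  by apply/eqP; exact: xmax.
by rewrite ltnS leq_eqVlt => /predU1P[->//|]; exact: xmax.
Qed.

Lemma rank_min (x : nat -> edge) k : (forall j, j < k -> min_edge (x j)) ->
  rank x k = 0.
Proof.
elim: k => // k IH xmin /=; rewrite IH => [|j jk]; last exact/xmin/ltnW.
by have /eqP -> := xmin k (ltnSn k); rewrite /flatten_index take0.
Qed.

(** At the changed edge, the maximal segment of [x] ends its row of ranks and the minimal segment of
    [y] opens the next row. Hence the rank grows by exactly one there, and the unchanged edges above
    carry this upwards. *)
Lemma adic_step_rank (x y : path_space q a) : adic_step x y ->
  exists i, [/\ forall j, j < i -> max_edge q a j (x j),
    ~~ max_edge q a i (x i) &
    forall k, i < k -> state y k = (vertex_at x k, (rank x k).+1)].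
Proof.
move=> [i [xmax xi yi ymin yx]]; exists i; split=> //.
elim=> // k IH; rewrite ltnS leq_eqVlt => /predU1P[ik|ik]; last first.
  have [vk rk] := IH ik; rewrite /state /= yx //; congr pair.
  by rewrite rk /flatten_index addnS.
subst k; rewrite /state /= yi /=; congr pair; rewrite (rank_min ymin).
have [ei si] := path_edgeP x i; have /rank_max wi := xmax.
rewrite /flatten_index addn0 (take_nth 0) ?size_map // sumn_rcons.
rewrite (nth_map Root) // -/(source q a i (x i)) si -addnS wi.
by case: (i).
Qed.

Lemma adic_step_unique (x y z : path_space q a) :
  adic_step x y -> adic_step x z -> y = z.
Proof.
move=> /adic_step_rank[i [_ _ yi]] /adic_step_rank[j [_ _ zj]].
apply: state_inj => k; exists (maxn k (maxn i j).+1); first exact: leq_maxl.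
by rewrite yi ?zj //; lia.
Qed.

Lemma x_s_max k : max_edge q a k (x_s q a k).
Proof. by case: k. Qed.

Lemma adicE (x y : path_space q a) : adic_step x y -> adic x = Some y.
Proof.
move=> xy; rewrite /adic; case: xgetP => [_ _ [z [xz|[xs _]] <-]|].
- by rewrite (adic_step_unique xy xz).
- by move: xy => [i [_ + _ _ _]]; rewrite xs x_s_max.
- by move=> /(_ (Some y)) []; exists y => //; left.
Qed.

Lemma adic_max (x : path_space q a) : x <> x_s q a ->
  (forall j, max_edge q a j (x j)) -> adic x = None.
Proof.
move=> xs xmax; rewrite /adic; case: xgetP => // _ _ [z [xz|[]//] <-].
by move: xz => [i [_ + _ _ _]]; rewrite xmax.
Qed.

(** The minimal segment from the root to [v] stays on the side of [v], because the first edge into a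
    tower starts at a tower and edges into spacer vertices never do. The value at [Root] is a
    default. *)
Definition min_edge_to v : edge :=
  if v is SpacerVertex then (v, 0) else (Tower, 0).

Lemma min_edge_toP k v : is_edge q a k (min_edge_to v) /\
  source q a k (min_edge_to v) = if k is _.+1 then (min_edge_to v).1 else Root.
Proof.
by rewrite /is_edge /source; case: k v => [|k] [] //=; case: (q k) (q_gt0 k).
Qed.

Lemma exists_adic_step (x : path_space q a) i :
  ~~ max_edge q a i (x i) -> exists y, adic_step x y.
Proof.
move=> xi'; have ex : exists i, ~~ max_edge q a i (x i) by exists i.
case: (ex_minnP ex) => {xi' ex}i xi imin.
have [ei si] := path_edgeP x i.
have ei1 : is_edge q a i (next_edge (x i)).
  by rewrite /is_edge /= ltn_neqAle xi.
have [_ vi] := sources_vertex ei1.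
pose v := source q a i (next_edge (x i)).
(* Here [i] is the least nonmaximal level: minimal edges below it, the successor edge at it, and [x]
   above. *)
pose y j := if j < i then min_edge_to v else
  if j == i then next_edge (x i) else x j.
have yP : is_path q a y.
  move=> j; rewrite {1 2}/y; case: ltnP => [ji|].
    have [em sm] := min_edge_toP j v; split=> //; rewrite {}sm.
    by case: j ji {em} => // j ji; rewrite /y ifT // ltnW.
  rewrite leq_eqVlt => /predU1P[<-|ij].
    rewrite eqxx; split=> //; rewrite -/v /y.
    move: vi; rewrite -/(source q a i (next_edge (x i))) -/v.
    by case: (i) => [|k] /=; rewrite ?ltnSn; case: (v).
  rewrite gtn_eqF //; have [ej sj] := path_edgeP x j; split=> //; rewrite sj.
  case: j ij {ej sj} => // j; rewrite ltnS leq_eqVlt /y => /predU1P[->|ij].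
    by rewrite ltnn eqxx.
  by rewrite ltnNge (ltnW ij) /= gtn_eqF.
exists (PathSpace yP); exists i; split=> //=.
- by move=> j ji; apply: contraLR ji => /imin; rewrite -leqNgt.
- by rewrite /y ltnn eqxx.
- by move=> j ji; rewrite /y ji; case: (v).
- by move=> j ij; rewrite /y ltnNge (ltnW ij) /= gtn_eqF.
Qed.

(** A rank other than the last forces a nonmaximal edge below level [k], so every edge that T
    changes lies below level [k]. *)
Lemma adic_succ (x : path_space q a) k :
  (rank x k).+1 < weight k (vertex_at x k) ->
  exists2 y, adic x = Some y &
    forall j, k <= j -> state y j = (vertex_at x j, (rank x j).+1).
Proof.
move=> xk; have [j jk xj] : exists2 j, j < k & ~~ max_edge q a j (x j).
  apply: contrapT => nex; move: xk.
  suff -> : (rank x k).+1 = weight k (vertex_at x k).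
    by rewrite ltnn.
  by apply/rank_max => j jk; apply/negPn/negP => xj; apply: nex; exists j.
have [y xy] := exists_adic_step xj; exists y; first exact: adicE.
have [i [xmax _ yi]] := adic_step_rank xy; move=> l kl; apply: yi.
rewrite (leq_trans _ kl) // (leq_ltn_trans _ jk) // leqNgt.
by apply: contra xj => /xmax.
Qed.

Lemma is_vertex_at (x : path_space q a) k : is_vertex k (vertex_at x k).
Proof. by have /andP[] := is_state_rank x k. Qed.

Lemma state_spacer (x : path_space q a) k :
  vertex_at x k = SpacerVertex -> state x k = (SpacerVertex, 0).
Proof.
have /andP[_ /=] := is_state_rank x k; rewrite /state => /[swap] ->.
by case: (rank x k).
Qed.

(** Above level 1 a spacer vertex is entered only from a spacer vertex, so a path that has reached a
    tower stays in towers; a path that never reaches one is [x_s]. *)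
Lemma vertex_at_tower (x : path_space q a) : x <> x_s q a ->
  exists L, forall k, L <= k -> vertex_at x k = Tower.
Proof.
move=> xs; have [L xL] : exists L, vertex_at x L.+1 = Tower.
  apply: contrapT => nT; apply: xs; apply: state_inj => k; exists k.+1 => //.
  rewrite (@state_spacer x) ?(@state_spacer (x_s q a)) //.
  have := is_vertex_at x k.+1.
  by case E : (vertex_at x k.+1) => // _; case: nT; exists k.
exists L.+1 => k /subnKC <-; elim: (k - _) => [|i IH]; first by rewrite addn0.
rewrite addnS; have := is_vertex_at x (L.+1 + i).+1.
have := @state_spacer x (L.+1 + i).+1.
case: (vertex_at x (L.+1 + i).+1) => // /(_ erefl) xL1 _.
have /(congr1 fst) := descend_state x (L.+1 + i).
by rewrite xL1 -[RHS]/(vertex_at x (L.+1 + i)) IH.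
Qed.

End path_states.

(** * Coding by an odometer *)

Lemma modulus_dvd_le (m : odometer_base) i j : i <= j -> m i %| m j.
Proof.
move=> /subnKC <-; elim: (j - i) => [|d IH]; first by rewrite addn0.
by rewrite addnS (dvdn_trans IH) ?modulus_dvd.
Qed.

Lemma residue_mod_le (m : odometer_base) (y : odometer m) i j :
  i <= j -> y j %% m i = y i.
Proof.
move=> /subnKC <-; elim: (j - i) => [|d IH].
  by rewrite addn0 residue_small.
have [_ yd] := residueP y (i + d).
by rewrite -IH -yd addnS modn_dvdm // modulus_dvd_le ?leq_addr.
Qed.

Lemma odometer_mapE (m : odometer_base) (y : odometer m) i :
  odometer_map y i = (y i).+1 %% m i.
Proof. by rewrite /odometer_map /= modnDmr addn1. Qed.

Lemma iter_shift (m : odometer_base) (y : odometer m) n i :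
  iter n (@odometer_map m) y i = (y i + n) %% m i.
Proof.
elim: n => [|n IH]; first by rewrite addn0 residue_small.
by rewrite iterS odometer_mapE IH -addn1 modnDml addn1 addnS.
Qed.

Lemma iter_shift0 (m : odometer_base) n i :
  iter n (@odometer_map m) (odometer0 m) i = n %% m i.
Proof. by rewrite iter_shift /= mod0n. Qed.

(** * Positions in a list of sources *)

Section lookup.
Variables (h b : nat) (w : vertex -> nat).
Hypotheses (wT : w Tower = h) (wS : w SpacerVertex = 1).

(** The computation of [descend] for an arbitrary list of sources, which allows recursion on the
    list. *)
Definition lookup (s : seq vertex) c :=
  (nth Root s (reshape_index (map w s) c), reshape_offset (map w s) c).

Lemma lookup_cons v s c :
  lookup (v :: s) c = if c < w v then (v, c) else lookup s (c - w v).
Proof.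
rewrite /lookup /reshape_offset /reshape_index /=.
rewrite subn_eq0; case: ltnP => [_|vc] /=; first by rewrite subn0.
by rewrite subSn // subnDA.
Qed.

Lemma lookup_spacers n s c : lookup (nseq n SpacerVertex ++ s) c =
  if c < n then (SpacerVertex, 0) else lookup s (c - n).
Proof.
elim: n c => [|n IH] c; first by rewrite subn0.
rewrite [_ ++ _]/= lookup_cons wS; case: c => // c.
by rewrite subn1 IH.
Qed.

(** The list describes a prefix of the powers of one tower followed by [b] spacers; each induction
    step removes one period, which leaves the remainder modulo [h + b] unchanged. *)
Lemma lookup_towers k c : 0 < h -> c < k * (h + b) + h ->
  lookup
    (flatten [seq Tower :: nseq j SpacerVertex | j <- nseq k b ++ [:: 0]]) c =
  if c %% (h + b) < h then (Tower, c %% (h + b)) else (SpacerVertex, 0).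
Proof.
move=> h_gt0; elim: k c => [|k IH] c ck; rewrite [nseq _ b ++ _]/= map_cons.
  by rewrite /= lookup_cons wT ck modn_small ?ck //; lia.
rewrite [flatten _]/= lookup_cons wT lookup_spacers.
case: (ltnP c h) => [ch|hc]; first by rewrite modn_small ?ch //; lia.
case: ltnP => cb; first by rewrite modn_small ?ltnNge ?hc //; lia.
rewrite IH; last by rewrite mulSn in ck; lia.
by rewrite -subnDA -[in RHS](@subnK (h + b) c) ?modnDr //; lia.
Qed.

End lookup.

(** * The correspondence between points of the odometer and paths *)

Section regular.
Variables (q : nat -> nat) (a : nat -> nat -> nat).
Hypothesis q_gt0 : forall n, 0 < q n.
Variables N a0 : nat.
Hypothesis a_reg : forall n, N <= n ->
  a n (q n).-1 = 0 /\ forall i, i < (q n).-1 -> a n i = a0.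

Local Notation h n := (size (block q a n)).

Lemma spacers_reg n : N <= n ->
  [seq a n i | i <- iota 0 (q n)] = nseq (q n).-1 a0 ++ [:: 0].
Proof.
move=> /a_reg[an ai]; rewrite -[in iota _ _](prednK (q_gt0 n)) -addn1 iotaD.
rewrite map_cat /= an; congr cat; apply: (@eq_from_nth _ 0).
  by rewrite size_map size_iota size_nseq.
rewrite size_map size_iota => i iq.
by rewrite (nth_map 0) ?size_iota // nth_iota // nth_nseq iq ai.
Qed.

(** The added [s^a0] completes the last [B_n], the only copy with no spacers after it. *)
Lemma heightS n : N <= n -> h n.+1 + a0 = q n * (h n + a0).
Proof.
move=> nN; have -> : h n.+1 =
    sumn [seq h n + i | i <- [seq a n i | i <- iota 0 (q n)]].
  rewrite -map_comp /= size_flatten /shape -map_comp; congr sumn.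
  by apply: eq_map => i /=; rewrite size_cat size_nseq.
rewrite spacers_reg // map_cat sumn_cat map_nseq sumn_nseq /=.
by rewrite -{2}(prednK (q_gt0 n)) mulSn; lia.
Qed.

(* The state at level n.+1 of the path sitting at position c of
   B_n s^a0; the positions in s^a0 are sent to the spacer vertex. *)
Definition base_state n c := if c < h n then (Tower, c) else (SpacerVertex, 0).

Lemma is_state_base n c : is_state q a n.+1 (base_state n c).
Proof. by rewrite /base_state /is_state; case: ifP. Qed.

Lemma base_state_inj n c d :
  c < h n -> base_state n c = base_state n d -> c = d.
Proof. by rewrite /base_state => ->; case: ifP => // _ []. Qed.

(* B_{n+1} s^a0 is a power of B_n s^a0. *)
Lemma descend_base n c : N <= n -> c < h n.+1 + a0 ->
  descend q a n.+1 (base_state n.+1 c) = base_state n (c %% (h n + a0)).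
Proof.
move=> nN cH; have hn := block_gt0 a q_gt0 n; rewrite /base_state.
have Hq := heightS nN; have qn := q_gt0 n.
case: ltnP => [ch|hc]; last first.
  rewrite /descend /= ifF //; apply/negbTE; rewrite -leqNgt.
  (* The final [s^a0] of [B_{n+1} s^a0] is the one that follows its last [B_n]. *)
  have -> : c = (q n).-1 * (h n + a0) + (h n + (c - h n.+1)).
    by move: Hq; rewrite -{1}(prednK qn) mulSn; lia.
  by rewrite modnMDl modn_small; lia.
rewrite /descend -/(lookup _ _ _) /=.
have -> : [seq Tower :: nseq (a n j) SpacerVertex | j <- iota 0 (q n)] =
    [seq Tower :: nseq j SpacerVertex | j <- [seq a n i | i <- iota 0 (q n)]].
  by rewrite -map_comp.
rewrite spacers_reg // (@lookup_towers (h n)) //.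
by move: Hq; rewrite -{1}(prednK qn) mulSn; lia.
Qed.

Variable m : odometer_base.
Hypothesis mE : forall i, m i = h (N + i) + a0.

Let y_lt (y : odometer m) i : y i < h (N + i) + a0.
Proof. by rewrite -mE; have [] := residueP y i. Qed.

(** Carries a state from level [k + d] down to level [k]. *)
Let down := fix down d k s :=
  if d is e.+1 then down e k (descend q a (k + e) s) else s.

Let descend_down d k s : descend q a k (down d k.+1 s) = down d.+1 k s.
Proof.
elim: d s => [|d IH] s; first by rewrite /= addn0.
by rewrite [down d.+1 _ _]/= IH [in RHS]/= addSnnS.
Qed.

Lemma exists_decoding (y : odometer m) : exists x : path_space q a,
  forall i, state q a x (N + i).+1 = base_state (N + i) (y i).
Proof.
(* The residues of [y] give states only above level [N]. Descending [N.+1] levels from level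
   [N + k + 1] yields a state at every level [k]. *)
pose S k := down N.+1 k (base_state (N + k) (y k)).
have base_step i : descend q a (N + i).+1 (base_state (N + i.+1) (y i.+1)) =
    base_state (N + i) (y i).
  rewrite addnS descend_base ?leq_addr //; last by rewrite -addnS y_lt.
  by rewrite -mE; have [_ ->] := residueP y i.
have base_down d i : down d (N + i).+1 (base_state (N + (i + d)) (y (i + d))) =
    base_state (N + i) (y i).
  elim: d => [|d IH]; first by rewrite addn0.
  by rewrite /= addnS addSn -[N + i + d]addnA base_step.
have [|k|x xS] := @exists_path q a S.
- move=> k; rewrite /S.
  have : is_state q a (k + N.+1) (base_state (N + k) (y k)).
    by rewrite addnS addnC is_state_base.
  elim: N.+1 (base_state _ _) => [|d IH] s; first by rewrite addn0.
  by rewrite addnS => /is_state_descend/IH.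
- rewrite /S descend_down -[LHS]/(down N.+1 k (descend q a (k + N.+1) _)).
  by rewrite [k + _]addnS [k + N]addnC base_step.
- exists x => i; rewrite xS /S.
  have -> : (N + i).+1 = i + N.+1 by lia.
  by rewrite -[in RHS](base_down N.+1) addnS [i + N]addnC.
Qed.

Definition path_of (y : odometer m) := sval (cid (exists_decoding y)).

Lemma state_path_of y i :
  state q a (path_of y) (N + i).+1 = base_state (N + i) (y i).
Proof. by rewrite /path_of; case: cid. Qed.

Lemma path_of_eventually (y : odometer m) (x : path_space q a) :
  (exists I, forall i, I <= i ->
     state q a x (N + i).+1 = base_state (N + i) (y i)) -> path_of y = x.
Proof.
move=> [I xI]; apply: state_inj => k; exists (N + (I + k)).+1; first by lia.
by rewrite state_path_of xI ?leq_addr.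
Qed.

Lemma path_of_tower (y : odometer m) : path_of y <> x_s q a ->
  exists I, forall i, I <= i -> y i < h (N + i).
Proof.
move=> /vertex_at_tower[L yL]; exists L => i Li.
have : vertex_at (path_of y) (N + i).+1 = Tower by apply: yL; lia.
have := state_path_of y i => /(congr1 fst) /= ->.
by rewrite /base_state; case: ltnP.
Qed.

(** From some level on the path is in towers, where its state shows the residue; residues of lower
    index follow by reduction. *)
Lemma path_of_inj (y z : odometer m) :
  path_of y <> x_s q a -> path_of y = path_of z -> y = z.
Proof.
move=> /path_of_tower[I yI] yz; apply: odometer_ext => i.
suff yzj : y (I + i) = z (I + i).
  by rewrite -(residue_mod_le _ (leq_addl I i)) yzj residue_mod_le ?leq_addl.
apply: (@base_state_inj (N + (I + i))); first exact/yI/leq_addr.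
by rewrite -!state_path_of yz.
Qed.

Lemma path_of_surj (x : path_space q a) : x <> x_s q a ->
  exists y, path_of y = x.
Proof.
move=> /vertex_at_tower[L xL].
have rank_small i : L <= i -> rank q a x i.+1 < h i.
  move=> Li; have /andP[_ /=] := is_state_rank x i.+1.
  by rewrite -[(x i).1]/(vertex_at x i.+1) xL //; lia.
have state_x i : L <= i -> state q a x i.+1 = base_state i (rank q a x i.+1).
  by move=> Li; rewrite /state xL ?leqW // /base_state rank_small.
have rank_mod i : L <= N + i ->
    rank q a x (N + i.+1).+1 %% m i = rank q a x (N + i).+1.
  move=> Li; apply/esym/(@base_state_inj (N + i)); first exact: rank_small.
  rewrite -state_x // -descend_state addnS state_x ?leqW //.
  rewrite descend_base ?leq_addr ?mE //.
  by rewrite (leq_trans (rank_small _ _)) ?leq_addr //; lia.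
(* The residue of index [i] is read off [L] levels higher, where the path is certainly in towers,
   and then reduced modulo [m i]. *)
have rank_eq i : rank q a x (N + (L + i.+1)).+1 =
    rank q a x (N + (L + i)).+1 %[mod m i].
  rewrite [L + i.+1]addnS -[in RHS]rank_mod; last by lia.
  by rewrite modn_dvdm ?modulus_dvd_le ?leq_addl.
exists (of_seq rank_eq); apply: path_of_eventually; exists L => i Li.
rewrite state_x; last by lia.
congr base_state; rewrite /= mE.
have : forall d, rank q a x (N + (d + i)).+1 %% m i = rank q a x (N + i).+1.
  elim=> [|d IH].
    rewrite add0n modn_small // mE.
    by rewrite (leq_trans (rank_small _ _)) ?leq_addr //; lia.
  rewrite -IH -[in RHS]rank_mod; last by lia.
  by rewrite modn_dvdm ?modulus_dvd_le ?leq_addl.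
by rewrite -mE => /(_ L).
Qed.

Local Notation shift := (@odometer_map m).

Let tower_path_of (y : odometer m) i : y i < h (N + i) ->
  vertex_at (path_of y) (N + i).+1 = Tower /\
  rank q a (path_of y) (N + i).+1 = y i.
Proof.
move=> yi; have := state_path_of y i; rewrite /base_state yi => st.
by split; [have := congr1 fst st | have := congr1 snd st].
Qed.

(** The excluded point is [-(a0 + 1)], whose residues [h (N + i) - 1] are the last positions in the
    blocks. For any other point the residues eventually avoid the last position, so T and the shift
    both add one without carry. *)
Lemma path_of_adic (y : odometer m) : path_of y <> x_s q a ->
  iter a0.+1 shift y <> odometer0 m ->
  adic (path_of y) = Some (path_of (shift y)) /\ path_of (shift y) <> x_s q a.
Proof.
move=> /path_of_tower[I yI] y0.
have [i0 yi0] : exists i, (y i + a0.+1) %% m i <> 0.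
  apply: contrapT => y_eq; apply: y0; apply: odometer_ext => i.
  rewrite iter_shift /= mod0n; apply: contrapT => yi.
  by apply: y_eq; exists i.
(* Equality would give [y i + a0.+1 = m i], a multiple of [m i0], against the choice of [i0]. *)
have y_succ i : I + i0 <= i -> (y i).+1 < h (N + i).
  move=> Ii; rewrite ltn_neqAle yI ?andbT; last by lia.
  apply/eqP => yi; apply: yi0.
  rewrite -(@residue_mod_le _ y i0 i); last by lia.
  rewrite modnDml -addSnnS yi -mE; apply/eqP/modulus_dvd_le; lia.
have st i : I + i0 <= i -> vertex_at (path_of y) (N + i).+1 = Tower /\
    rank q a (path_of y) (N + i).+1 = y i.
  by move=> Ii; apply/tower_path_of/yI; lia.
pose i := I + i0.
have [|z yz zst] := @adic_succ q a q_gt0 (path_of y) (N + i).+1.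
  have [-> ->] := st i (leqnn _).
  exact: y_succ.
have zst' j : i <= j -> state q a z (N + j).+1 = (Tower, (y j).+1).
  move=> ij; rewrite zst; last by rewrite ltnS leq_add2l.
  by have [-> ->] := st j ij.
have zE : path_of (shift y) = z.
  apply: path_of_eventually; exists i => j ij; rewrite zst' //.
  rewrite odometer_mapE modn_small; last first.
    by rewrite mE (leq_trans (y_succ j ij)) ?leq_addr.
  by rewrite /base_state y_succ.
rewrite yz zE; split=> // zs.
by have := zst' i (leqnn _); rewrite zs.
Qed.

Lemma path_of_maximal (y : odometer m) : path_of y <> x_s q a ->
  iter a0.+1 shift y = odometer0 m -> adic (path_of y) = None.
Proof.
move=> ys y0; apply: adic_max => // j; have [I yI] := path_of_tower ys.
pose i := I + j.
(* The sum [y i + a0.+1] is a positive multiple of [m i] and does not exceed [m i]. *)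
have yi : (y i).+1 = h (N + i).
  have := iter_shift y a0.+1 i; rewrite y0 [LHS]mod0n mE => /esym/eqP.
  have yih : y i < h (N + i) := yI i (leq_addr _ _).
  by rewrite -/(dvdn _ _) => /dvdnP[[|[|k]]]; rewrite ?mulSn; nia.
have /rank_max : (rank q a (path_of y) (N + i).+1).+1 =
    weight q a (N + i).+1 (vertex_at (path_of y) (N + i).+1).
  by have [-> ->] := tower_path_of (yI i (leq_addr _ _)); rewrite yi.
by apply=> //; rewrite /i; lia.
Qed.

Lemma path_of0 : path_of (odometer0 m) = x_min a q_gt0.
Proof.
apply: path_of_eventually; exists 0 => i _; rewrite /= mod0n /base_state.
by rewrite block_gt0 // /state rank_min.
Qed.

(** All residues lie in the final [s^a0], so the distances [m i - y i] are between 1 and [a0]. They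
    agree modulo [m i] from one level to the next, hence are equal, and [y] is minus their common
    value. *)
Lemma path_of_x_s (y : odometer m) : path_of y = x_s q a ->
  exists n, iter n shift y = odometer0 m.
Proof.
move=> ys; have hy i : h (N + i) <= y i.
  have := state_path_of y i; rewrite ys /base_state.
  by case: ltnP => // _ /(congr1 fst).
exists (m 0 - y 0); apply: odometer_ext => i; rewrite iter_shift /= mod0n.
have yb j : m j.+1 - y j.+1 = m j - y j.
  have yj := y_lt y j; have yj1 := y_lt y j.+1.
  have hj := hy j; have hj1 := hy j.+1.
  have hgt := block_gt0 a q_gt0 (N + j).
  have : (y j + (m j.+1 - y j.+1)) %% m j = 0.
    have [_ <-] := residueP y j.
    rewrite modnDml subnKC; last by rewrite mE ltnW.
    exact/eqP/modulus_dvd.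
  move=> /eqP; rewrite -/(dvdn _ _) => /dvdnP[k].
  by case: k => [|[|k]]; rewrite ?mulSn !mE; nia.
have -> : m 0 - y 0 = m i - y i by elim: i => // i ->; rewrite yb.
by rewrite subnKC ?modnn // mE ltnW // y_lt.
Qed.

(** The forward orbit of 0 avoids both exceptions of [path_of_adic], so all iterates of T at [x_min]
    are defined: take a modulus too large for any wrapping. *)
Lemma orbit0 n : path_of (iter n shift (odometer0 m)) <> x_s q a /\
  iter n.+1 shift (odometer0 m) <> odometer0 m.
Proof.
have [i ni] : exists i, n.+1 + a0 < m i.
  have /cvgnyPgt/(_ (n.+1 + a0))[i _ /(_ i (leqnn _))] := @modulus_oo m.
  by exists i.
have small : n < h (N + i) by rewrite mE in ni; lia.
split=> [ns|n0].
  have := state_path_of (iter n shift (odometer0 m)) i.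
  rewrite ns iter_shift0 modn_small; last by lia.
  by rewrite /base_state small => /(congr1 fst).
have := iter_shift0 m n.+1 i; rewrite n0 [LHS]mod0n modn_small //; lia.
Qed.

Lemma x_min_coding_periodic k : exists c,
  is_coding k (x_min a q_gt0) c /\ is_periodic c.
Proof.
pose z n := path_of (iter n shift (odometer0 m)).
exists (fun n => alpha k (z n)); split.
  exists z; split=> //; first exact: path_of0.
  move=> n; have [zs _] := orbit0 n.
  have [|-> //] := path_of_adic zs; rewrite -iterD.
  by have [] := orbit0 (a0 + n).
(* The first [k] edges depend only on the state at level [N + k + 1], hence only on [n] modulo
   [m k]. *)
exists (mkseq (fun n => alpha k (z n)) (m k)); split.
  by rewrite size_mkseq modulus_gt0.
move=> n; rewrite size_mkseq nth_mkseq ?ltn_pmod ?modulus_gt0 //.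
apply/state_alpha/(@state_down _ _ _ _ _ (N + k).+1); first by lia.
by rewrite !state_path_of !iter_shift0 modn_mod.
Qed.

End regular.

(** * Cylinders *)

Section odometer_topology.
Variable m : odometer_base.

Lemma open_residue i c : open [set y : odometer m | y i = c].
Proof.
exists [set [set y : odometer m | y i = c]]; last by rewrite bigcup_set1.
by move=> _ ->; exact: (@finI_from1 _ _ _ _ (i, c)).
Qed.

(** A basic open set constrains finitely many residues, and the one of largest index determines the
    others. *)
Lemma open_odometerP (U : set (odometer m)) (y : odometer m) : open U -> U y ->
  exists i, forall z : odometer m, z i = y i -> U z.
Proof.
pose b (p : nat * nat) := [set z : odometer m | z p.1 = p.2].
move=> oU; have [D Dfin <-] : exists2 D : set (set (odometer m)),
    D `<=` finI_from setT b & \bigcup_(A in D) A = U.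
  by move: oU => [D Dfin DU]; exists D.
move=> [A DA Ay]; have [F _ FA] := Dfin _ DA.
exists (\max_(p <- F) p.1) => z zy; exists A => //.
move: Ay; rewrite -FA => Ay p pF; have yp : y p.1 = p.2 := Ay p pF.
have pi : p.1 <= \max_(p <- F) p.1 by exact: leq_bigmax_seq.
by rewrite /b /= -yp -(residue_mod_le z pi) zy residue_mod_le.
Qed.

Lemma odometer_openP (U : set (odometer m)) :
  (forall y : odometer m, U y ->
     exists i, forall z : odometer m, z i = y i -> U z) ->
  open U.
Proof.
move=> UP; rewrite openE => y /UP[i iU]; rewrite /interior nbhsE /=.
by exists [set z : odometer m | z i = y i]; [split; [exact: open_residue|]|].
Qed.

Lemma continuous_odometer_map : continuous (@odometer_map m).
Proof.
apply/continuousP => U oU; apply: odometer_openP => y /= Uy.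
have [i iU] := open_odometerP oU Uy; exists i => z zy; apply: iU.
by rewrite !odometer_mapE zy.
Qed.

End odometer_topology.

Section path_topology.
Variables (q : nat -> nat) (a : nat -> nat -> nat).

Lemma open_cylinder (x : path_space q a) k : open (cylinder (x, k)).
Proof.
exists [set cylinder (x, k)]; last by rewrite bigcup_set1.
by move=> _ ->; exact: finI_from1.
Qed.

Lemma open_pathP (U : set (path_space q a)) (x : path_space q a) :
  open U -> U x ->
  exists k, forall y : path_space q a, state q a y k = state q a x k -> U y.
Proof.
move=> oU; have [D Dfin <-] : exists2 D : set (set (path_space q a)),
    D `<=` finI_from setT (@cylinder q a) & \bigcup_(A in D) A = U.
  by move: oU => [D Dfin DU]; exists D.
move=> [A DA Ax]; have [F _ FA] := Dfin _ DA.
exists (\max_(p <- F) p.2) => y yx; exists A => //.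
move: Ax; rewrite -FA => Ax p pF; rewrite /cylinder /= -(Ax p pF).
have pi : p.2 <= \max_(p <- F) p.2 by exact: leq_bigmax_seq.
by apply/state_alpha; exact: state_down yx.
Qed.

Lemma path_openP (U : set (path_space q a)) :
  (forall x : path_space q a, U x -> exists k,
     forall y : path_space q a, state q a y k = state q a x k -> U y) ->
  open U.
Proof.
move=> UP; rewrite openE => x /UP[k kU]; rewrite /interior nbhsE /=.
exists (cylinder (x, k)) => [|y yx]; first by split; first exact: open_cylinder.
by apply: kU; exact/state_alpha.
Qed.

Lemma open_setC1_path (x : path_space q a) : open [set~ x].
Proof.
apply: path_openP => y /eqP.
case: (pselect (exists k, state q a y k <> state q a x k)) => [[k kyx] _|yx].
  by exists k => z zy zx; apply: kyx; rewrite -zy zx.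
move=> /eqP[]; apply: state_inj => k; exists k => //.
by apply: contrapT => ?; apply: yx; exists k.
Qed.

End path_topology.

(** * Haar measure of an odometer *)

Section unit_mass.
Context d (T : measurableType d) (R : realType).
Variable mu : {measure set T -> \bar R}%R.

(** Takes the proof of unit mass as an argument so that a probability structure can be attached to
    it. *)
Definition unit_mass_probability (mu1 : mu setT = 1%E) : set T -> \bar R := mu.

Hypothesis mu1 : mu setT = 1%E.

HB.instance Definition _ := Measure.on (unit_mass_probability mu1).
HB.instance Definition _ :=
  Measure_isProbability.Build _ _ _ (unit_mass_probability mu1) mu1.

Lemma exists_probability : exists P : probability T R, forall A, P A = mu A.
Proof. by exists (unit_mass_probability mu1). Qed.

End unit_mass.

Lemma pushforward_probability d d' (T : measurableType d)
    (T' : measurableType d') (R : realType) (P : probability T R)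
    (f : T -> T') : measurable_fun setT f ->
  exists Q : probability T' R, forall A, Q A = P (f @^-1` A).
Proof.
move=> mf; pose fmix := isMeasurableFun.Build _ _ _ _ f mf.
pose X : {mfun T >-> T'} := HB.pack f fmix.
by exists (distribution P X).
Qed.

Section odometer_measures.
Variable m : odometer_base.
Local Notation Y := (borel (odometer m)).

Definition residue_set i c : set Y := [set y : odometer m | y i = c].

Definition residue_sets : set (set Y) :=
  [set A | exists i c, A = residue_set i c].

Lemma measurable_residue_set i c : measurable (residue_set i c).
Proof. by apply: sub_sigma_algebra; exact: open_residue. Qed.

(** There are countably many residue sets and every open set is the union of those it contains. *)
Lemma measurable_odometerE : @measurable _ Y = <<s residue_sets >>.
Proof.
apply/seteqP; split; last first.
  apply: smallest_sub; first exact: smallest_sigma_algebra.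
  by move=> _ [i [c ->]]; exact: measurable_residue_set.
apply: smallest_sub; first exact: smallest_sigma_algebra.
move=> U oU; pose F (p : nat * nat) : set Y :=
  if `[<residue_set p.1 p.2 `<=` U>] then residue_set p.1 p.2 else set0.
have -> : U = \bigcup_p F p.
  apply/seteqP; split=> [y Uy|y [p _]]; rewrite /F; last first.
    by case: asboolP => [sub /sub|_ []].
  have [i iU] := open_odometerP oU Uy; exists (i, (y : odometer m) i) => //.
  by rewrite asboolT.
apply: (@countable_bigcupT_measurable _ (g_sigma_algebraType residue_sets)).
  exact: countableP.
move=> p; rewrite /F; case: asboolP => _; last exact: measurable0.
by apply: sub_sigma_algebra; exists p.1, p.2.
Qed.

Lemma residue_sets_setI : setI_closed residue_sets.
Proof.
have H i j c e : i <= j -> residue_sets (residue_set i c `&` residue_set j e).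
  move=> ij; have [ec|ec] := eqVneq (e %% m i) c.
    exists j, e; apply/seteqP; split=> [y []//|y ye]; split=> //.
    by rewrite /residue_set /= -(residue_mod_le _ ij) ye.
  (* Incompatible residues have empty intersection, represented by the impossible residue [m 0] at
     index 0. *)
  exists 0, (m 0); apply/seteqP; split=> y; rewrite /residue_set /=.
    by move=> [yi yj]; move: ec; rewrite -yj residue_mod_le // yi eqxx.
  by move=> y0; have [] := residueP (y : odometer m) 0; rewrite y0 ltnn.
move=> _ _ [i [c ->]] [j [e ->]].
have [ij|/ltnW ji] := leqP i j; first exact: H.
by rewrite setIC; exact: H.
Qed.

Lemma odometer_measure_eq (R : realType) (P Q : probability Y R) :
  (forall i c, c < m i -> P (residue_set i c) = Q (residue_set i c)) ->
  forall A, measurable A -> P A = Q A.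
Proof.
move=> PQ; apply: (measure_unique residue_sets (residue_set 0)).
- exact: measurable_odometerE.
- exact: residue_sets_setI.
- by move=> c; exists 0, c.
- by apply/seteqP; split=> // y _; exists ((y : odometer m) 0).
- move=> _ [i [c ->]]; have [ci|ci] := ltnP c (m i); first exact: PQ.
  have -> : residue_set i c = set0; last by rewrite !measure0.
  apply/seteqP; split=> // y yc; have [+ _] := residueP (y : odometer m) i.
  by rewrite yc ltnNge ci.
- move=> c; apply: (le_lt_trans (probability_le1 _ _)).
    exact: measurable_residue_set.
  by rewrite ltry.
Qed.

Lemma trivIset_residue_set i D : trivIset D (residue_set i).
Proof.
apply/trivIsetP => c e _ _ /eqP ce; apply/seteqP; split=> // y [yc ye].
by case: ce; rewrite -yc -ye.
Qed.

Lemma preimage_shift_residue i c : c.+1 < m i ->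
  @odometer_map m @^-1` residue_set i c.+1 = residue_set i c.
Proof.
move=> ci; apply/seteqP; split=> y.
  rewrite -[X in X -> _]/(odometer_map y i = c.+1) odometer_mapE.
  have [yi _] := residueP (y : odometer m) i.
  move: yi; rewrite leq_eqVlt => /predU1P[->|yi]; first by rewrite modnn.
  by rewrite modn_small // => -[].
move=> yc; suff : odometer_map y i = c.+1 by [].
by rewrite odometer_mapE yc modn_small.
Qed.

(** The shift moves each of the [m i] residue sets onto the next, so they have equal mass, and they
    partition the odometer. *)
Lemma shift_invariant_residue (R : realType) (P : probability Y R) :
  (forall A : set Y, measurable A -> P (@odometer_map m @^-1` A) = P A) ->
  forall i c, c < m i -> P (residue_set i c) = ((m i)%:R^-1)%:E.
Proof.
move=> Pinv i.
have Pc c : c < m i -> P (residue_set i c) = P (residue_set i 0).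
  elim: c => // c IH ci; rewrite -(IH (ltnW ci)) -Pinv; last first.
    exact: measurable_residue_set.
  by rewrite preimage_shift_residue.
have : P (\big[setU/set0]_(c < m i) residue_set i c) = 1%E.
  rewrite -(probability_setT P); congr (P _); rewrite -bigcup_mkord.
  apply/seteqP; split=> // y _; exists ((y : odometer m) i) => //=.
  by have [] := residueP (y : odometer m) i.
rewrite measure_bigsetU_ord //; last 2 first.
- by move=> c; exact: measurable_residue_set.
- apply/trivIsetP => c e _ _ ce.
  by have /trivIsetP := @trivIset_residue_set i setT; apply.
rewrite (eq_bigr (fun=> P (residue_set i 0))); last first.
  by move=> c _; exact: (Pc c (ltn_ord c)).
have Pfin : P (residue_set i 0) \is a fin_num.
  by apply: fin_num_measure; exact: measurable_residue_set.
rewrite -[P (residue_set i 0)]fineK //.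
rewrite sumEFin => -[]; rewrite sumr_const card_ord => Pm c ci.
rewrite Pc // -[LHS]fineK //; congr EFin.
have mi : ((m i)%:R != 0 :> R)%R by rewrite pnatr_eq0 -lt0n modulus_gt0.
by apply: (mulfI mi); rewrite mulfV // mulr_natl.
Qed.

Lemma measurable_to_odometer d (T : measurableType d) (f : T -> Y) :
  (forall i c, measurable (f @^-1` residue_set i c)) -> measurable_fun setT f.
Proof.
move=> mf; apply: (measurability residue_sets).
  exact: measurable_odometerE.
by move=> _ [_ [i [c ->]] <-]; rewrite setTI.
Qed.

Definition factor i := m i.+1 %/ m i.

Lemma factorE i : m i.+1 = factor i * m i.
Proof. by rewrite /factor divnK // modulus_dvd. Qed.

Lemma factor_gt0 i : 0 < factor i.
Proof. by have := modulus_gt0 m i.+1; rewrite factorE muln_gt0 => /andP[]. Qed.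

(* With m_{i+1} = k m_i, the floor of x m_i is the quotient by k of the floor of
   x m_{i+1}, whereas y_i is the remainder of y_{i+1} modulo m_i: reversing the
   mixed radix digits turns [0, 1) into the odometer, and Lebesgue measure into
   its Haar measure. *)
Fixpoint reverse_digits i t :=
  if i is j.+1 then reverse_digits j (t %/ factor j) + m j * (t %% factor j)
  else t.

Lemma reverse_digits_lt i t : t < m i -> reverse_digits i t < m i.
Proof.
elim: i t => // i IH t; rewrite /= factorE => tm.
have := IH _ (_ : t %/ factor i < m i).
rewrite ltn_divLR ?factor_gt0 // mulnC => /(_ tm).
have := ltn_pmod t (factor_gt0 i).
nia.
Qed.

(** The remainder of [c] modulo [m i] determines the quotient of [t] by [factor i], and the quotient
    of [c] determines its remainder. *)
Lemma reverse_digits_bij i c : c < m i ->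
  exists2 t, t < m i &
    forall t', t' < m i -> reverse_digits i t' = c <-> t' = t.
Proof.
have f_gt0 := factor_gt0.
elim: i c => [|i IH] c ci; first by exists c.
have mi := modulus_gt0 m i.
have [t tm tP] := IH (c %% m i) (ltn_pmod _ mi).
have cf : c %/ m i < factor i by rewrite ltn_divLR // -factorE.
exists (t * factor i + c %/ m i); first by rewrite factorE; nia.
move=> t' t'm /=.
have t'f : t' %/ factor i < m i by rewrite ltn_divLR // mulnC -factorE.
have r_lt := reverse_digits_lt t'f.
split=> [rc|->].
  rewrite [LHS](divn_eq t' (factor i)).
  have -> : t' %/ factor i = t.
    by apply/tP => //; rewrite -rc mulnC addnC modnMDl modn_small.
  congr (_ + _); rewrite -rc mulnC addnC divnMDl // divn_small ?addn0 //.
rewrite divnMDl // divn_small // addn0 modnMDl modn_small //.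
have /(tP _ tm) -> : t = t by [].
by rewrite addnC mulnC -divn_eq.
Qed.

End odometer_measures.

(** * Construction of Haar measure from Lebesgue measure *)

Section haar.
Variables (R : realType) (m : odometer_base).
Local Notation Y := (borel (odometer m)).

Lemma truncnM_nat (x : R) k : 0 < k ->
  Num.truncn (x * k%:R)%R %/ k = Num.truncn x.
Proof.
move=> k_gt0; have [x0|x0] := leP 0%R x; last first.
  have /eqP -> : Num.truncn x == 0.
    by rewrite -leqn0 truncn_le_nat (lt_trans x0).
  have /eqP -> : Num.truncn (x * k%:R)%R == 0.
    rewrite -leqn0 truncn_le_nat (lt_trans _ ltr01) // pmulr_llt0 ?ltr0n //.
  by rewrite div0n.
apply/eqP; rewrite eqn_leq -ltnS ltn_divLR // leq_divRL //.
rewrite truncn_lt_nat ?mulr_ge0 // truncn_ge_nat ?mulr_ge0 //.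
rewrite !natrM ler_pM2r ?ltr0n // ltr_pM2r ?ltr0n //.
by rewrite truncnS_gt truncn_le.
Qed.

Definition digits (x : R) i := reverse_digits m i (Num.truncn (x * (m i)%:R)%R).

Lemma digitsP (x : R) i : digits x i.+1 = digits x i %[mod m i].
Proof.
rewrite /digits /= addnC mulnC modnMDl factorE [factor m i * _]mulnC.
by rewrite natrM mulrA truncnM_nat ?factor_gt0.
Qed.

Definition odometer_digits (x : measurableTypeR R) : Y := of_seq (digitsP x).

Lemma measurable_odometer_digits : measurable_fun setT odometer_digits.
Proof.
apply: measurable_to_odometer => i c.
(* Superlevel sets of the truncation are half-lines, or everything for [n = 0]; consecutive
   differences are its level sets. *)
pose r n :=
  [set x : measurableTypeR R | n <= Num.truncn (x * (m i)%:R)%R].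
have mi : (0 < (m i)%:R :> R)%R by rewrite ltr0n modulus_gt0.
have mr n : measurable (r n).
  case: n => [|n]; first by rewrite (_ : r 0 = setT) //; apply/seteqP; split.
  rewrite (_ : r n.+1 = `[(n.+1%:R / (m i)%:R)%R, +oo[%classic) //.
  apply/seteqP.
  by split=> x; rewrite /r /= in_itv /= andbT truncn_gt_nat ler_pdivrMr.
rewrite (_ : _ @^-1` _ =
    \bigcup_(n in [set n | reverse_digits m i n %% m i = c])
      (r n `\` r n.+1)).
  by apply: bigcup_measurable => n _; exact: measurableD.
apply/seteqP; split=> [x xc|x [n nc [rn rn1]]].
  exists (Num.truncn (x * (m i)%:R)%R) => //.
  by split; rewrite /r /= ?ltnn.
suff : odometer_digits x i = c by [].
rewrite -nc /= /digits; congr (reverse_digits m i _ %% m i).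
by apply/eqP; rewrite eqn_leq rn andbT leqNgt; exact/negP.
Qed.

Lemma exists_haar : exists nu : probability Y R,
  forall i c, c < m i -> nu (@residue_set m i c) = ((m i)%:R^-1)%:E.
Proof.
pose I01 : set (measurableTypeR R) := `[0%R, 1%R[%classic.
have mI : measurable I01 by exact: measurable_itv.
have [|lam lamE] := @exists_probability _ (measurableTypeR R) R
  (mrestr lebesgue_measure mI).
  rewrite [LHS](_ : _ = lebesgue_measure I01); last by rewrite /= /mrestr setTI.
  by rewrite lebesgue_measure_itv /= lte01 oppr0 adde0.
have [nu nuE] := pushforward_probability lam measurable_odometer_digits.
exists nu => i c ci; rewrite nuE lamE /mrestr.
have mi : (0 < (m i)%:R :> R)%R by rewrite ltr0n modulus_gt0.
(* On [[0, 1)] the residue [c] corresponds to one value [t] of the truncation, that is, to an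
   interval of length [1 / m i]. *)
have [t tm tP] := reverse_digits_bij ci.
pose J : set R := `[(t%:R / (m i)%:R)%R, (t.+1%:R / (m i)%:R)%R[%classic.
transitivity (lebesgue_measure J); last first.
  rewrite lebesgue_measure_itv /= lte_fin ltr_pM2r ?invr_gt0 // ltr_nat ltnSn.
  by rewrite -EFinB -mulrBl -natrB // subSn // subnn mul1r.
have xP (x : measurableTypeR R) : (0 <= x < 1)%R ->
    @residue_set m i c (odometer_digits x) <->
    Num.truncn (x * (m i)%:R)%R = t.
  move=> /andP[x0 x1]; have xm : Num.truncn (x * (m i)%:R)%R < m i.
    by rewrite truncn_lt_nat ?mulr_ge0 ?ler0n // -[ltRHS]mul1r ltr_pM2r.
  rewrite -(tP _ xm) -[in X in _ <-> X](modn_small (reverse_digits_lt xm)).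
  by [].
rewrite /= /mrestr; congr (lebesgue_measure _).
apply/seteqP; split=> x; rewrite /I01 /J /= !in_itv /=.
  move=> [xc x01]; move/andP : (x01) => [x0 _].
  have /eqP := (xP x x01).1 xc.
  by rewrite truncn_eq ?mulr_ge0 ?ler0n // -ler_pdivrMr // -ltr_pdivlMr.
move=> /andP[tx xt]; have x0 : (0 <= x)%R.
  by rewrite (le_trans _ tx) // divr_ge0 ?ler0n.
have x01 : (0 <= x < 1)%R.
  rewrite x0 (lt_le_trans xt) // ler_pdivrMr // mul1r ler_nat //.
split=> //; apply/(xP x x01)/eqP.
by rewrite truncn_eq ?mulr_ge0 ?ler0n // -ler_pdivrMr // -ltr_pdivlMr // tx.
Qed.

End haar.

Lemma inv_modulus_small (R : realType) (m : odometer_base) (e : R) :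
  (0 < e)%R -> exists i, ((m i)%:R^-1 < e)%R.
Proof.
move=> e_gt0.
have /cvgnyPgt/(_ (Num.truncn e^-1))[i _ /(_ i (leqnn _)) mi] := @modulus_oo m.
exists i; rewrite invf_plt ?posrE ?ltr0n ?modulus_gt0 //.
by rewrite (lt_le_trans (truncnS_gt _)) // ler_nat.
Qed.

Lemma measurable_odometer_point (m : odometer_base) (y : borel (odometer m)) :
  measurable [set y].
Proof.
rewrite -[X in measurable X]setCK; apply: measurableC; apply: sub_sigma_algebra.
apply: odometer_openP => z zy.
have [i zyi] : exists i, z i <> (y : odometer m) i.
  apply: contrapT => nex; apply: zy; apply: odometer_ext => i.
  by apply: contrapT => ?; apply: nex; exists i.
by exists i => t ti ty; apply: zyi; rewrite -ti ty.
Qed.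

(** * Invariance of the measure that is uniform on residues *)

Section uniform_odometer_measure.
Variables (R : realType) (m : odometer_base).
Local Notation Y := (borel (odometer m)).
Variable nu : probability Y R.
Hypothesis nu_residue :
  forall i c, c < m i -> nu (@residue_set m i c) = ((m i)%:R^-1)%:E.

Lemma measurable_translation (w : odometer m) :
  measurable_fun [set: Y] ((fun z : odometer m => (w + z)%R) : Y -> Y).
Proof.
apply: measurable_to_odometer => i c; apply: sub_sigma_algebra.
apply: odometer_openP => y; rewrite /residue_set /= => yc.
by exists i => z zy; rewrite zy.
Qed.

(** It suffices to compare on residue sets, where translation by [w] pulls the residue [c] back to
    [c - w i] modulo [m i]. *)
Lemma translation_invariant (w : odometer m) (A : set Y) : measurable A ->
  nu ((fun z : odometer m => (w + z)%R) @^-1` A) = nu A.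
Proof.
move=> mA; have [Q QE] := pushforward_probability nu (measurable_translation w).
rewrite -QE; apply: odometer_measure_eq mA => i c ci.
have [wi _] := residueP w i.
rewrite QE nu_residue //.
rewrite -(nu_residue (ltn_pmod (c + (m i - w i)) (modulus_gt0 m i))).
congr (nu _); apply/seteqP; split=> y; rewrite /residue_set /=.
  move=> <-; rewrite modnDml.
  have -> : w i + y i + (m i - w i) = y i + m i by lia.
  by rewrite modnDr residue_small.
move=> ->; rewrite modnDmr addnCA subnKC; last exact: ltnW.
by rewrite modnDr modn_small.
Qed.

Lemma haar_of_residues : is_haar nu.
Proof.
move=> w A mA; rewrite -(translation_invariant (- w)%R mA); congr (nu _).
apply/seteqP; split=> [_ [z Az <-]|y Ay]; first by rewrite /= addKr.
by exists (- w + y)%R => //; rewrite addNKr.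
Qed.

Lemma shift_invariant (A : set Y) : measurable A ->
  nu (@odometer_map m @^-1` A) = nu A.
Proof.
move=> mA; rewrite -(translation_invariant (odometer1 m) mA); congr (nu _).
by apply/seteqP; split=> z; rewrite /= /odometer_map addrC.
Qed.

Lemma odometer_point_null (y : Y) : nu [set y] = 0%E.
Proof.
apply/eqP; rewrite eq_le measure_ge0 andbT; apply/lee_addgt0Pr => e e_gt0.
rewrite add0e; have [i ie] := inv_modulus_small m e_gt0.
pose c := (y : odometer m) i; have [ci _] := residueP (y : odometer m) i.
rewrite (@le_trans _ _ (nu (@residue_set m i c))) //.
  apply: le_measure; rewrite ?inE.
  - exact: measurable_odometer_point.
  - exact: measurable_residue_set.
  - by move=> _ ->.
by rewrite nu_residue // lee_fin ltW.
Qed.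

End uniform_odometer_measure.

(** * Measures transported from an odometer *)

Lemma countable_negligible d (T : measurableType d) (R : realType)
    (P : probability T R) (A : set T) :
  (forall x, measurable [set x] /\ P [set x] = 0%E) -> countable A ->
  P.-negligible A.
Proof.
move=> P0 /countable_injP[f finj].
have -> : A = \bigcup_n (A `&` f @^-1` [set n]).
  by apply/seteqP; split=> [x Ax|x [n _ []//]]; exists (f x).
apply: negligible_bigcup => n.
have [->|/set0P[x [Ax fx]]] := eqVneq (A `&` f @^-1` [set n]) set0.
  exact: negligible_set0.
have [mx Px] := P0 x; exists [set x]; split=> // y [Ay fy].
by apply: finj; rewrite ?inE // fx fy.
Qed.

Lemma measure_mod_null d (T : measurableType d) (R : realType)
    (P : probability T R) (A B N : set T) : measurable A -> measurable B ->
  P.-negligible N -> (forall x, ~ N x -> A x <-> B x) -> P A = P B.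
Proof.
move=> mA mB [M [mM M0 NM]] AB.
have part C : measurable C -> P C = P (C `\` M).
  move=> mC; rewrite (measureDI P mC mM) -[RHS]adde0; congr (_ + _)%E.
  by apply: (subset_measure0 _ mM _ M0) => //; exact: measurableI.
rewrite part // [in RHS]part //; congr (P _); apply/seteqP.
by split=> x [xC xM]; split=> //; apply/AB => // /NM.
Qed.

Lemma iter_shift_add (m : odometer_base) (y : odometer m) n :
  iter n (@odometer_map m) y = (y + odometer1 m *+ n)%R.
Proof.
elim: n => [|n IH]; first by rewrite mulr0n addr0.
by rewrite iterS IH /odometer_map mulrSr addrA.
Qed.

Lemma measurable_odometer_map (m : odometer_base) :
  measurable_fun [set: borel (odometer m)]
    (@odometer_map m : borel (odometer m) -> borel (odometer m)).
Proof.
apply: (@measurability _ _ (borel (odometer m)) (borel (odometer m)) _ _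
  (@open (odometer m))) => //.
move=> _ [U oU <-]; rewrite setTI; apply: sub_sigma_algebra.
by move/continuousP : (@continuous_odometer_map m); exact.
Qed.

Section almost_conjugacy.
Variables (R : realType) (q : nat -> nat) (a : nat -> nat -> nat).
Variable m : odometer_base.
Local Notation X := (path_space q a).
Local Notation BX := (borel X).
Local Notation Y := (borel (odometer m)).
Local Notation shift := (@odometer_map m).

Variables (T : X -> option X) (g : odometer m -> X) (xs : X).

(* A countable set containing all points where g fails to conjugate the shift
   to T. *)
Definition orbit_to_0 : set Y :=
  [set y | exists n, iter n shift y = odometer0 m].

Hypothesis g_cont : continuous g.
Hypothesis g_surj : forall x, x <> xs -> exists y, g y = x.
Hypothesis g_inj : forall y z, g y <> xs -> g y = g z -> y = z.
Hypothesis g_open : forall U, open U -> open (g @` U `&` [set~ xs]).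
Hypothesis g_conj : forall y, ~ orbit_to_0 y ->
  g y <> xs /\ T (g y) = Some (g (shift y)).

Lemma countable_orbit_to_0 : countable orbit_to_0.
Proof.
apply: (@sub_countable _ _ _ [set (- (odometer1 m *+ n))%R | n in [set: nat]]).
  apply: subset_card_le => y [n]; rewrite iter_shift_add => yn; exists n => //.
  by apply/eqP; rewrite eq_sym -addr_eq0; apply/eqP.
exact: (card_le_trans (card_image_le _ _)).
Qed.

Lemma shift_orbit_to_0 y : ~ orbit_to_0 y -> ~ orbit_to_0 (shift y).
Proof. by move=> yZ [n yn]; apply: yZ; exists n.+1; rewrite iterSr. Qed.

(** The inverse of [g] away from [xs]. At [xs] it is an arbitrary preimage, or 0 if there is
    none. *)
Definition position (x : X) : odometer m :=
  xget (odometer0 m) [set y | g y = x].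

Lemma positionK x : x <> xs -> g (position x) = x.
Proof.
by move=> /g_surj[y yx]; rewrite /position; case: xgetP => [_ _ //|/(_ y)].
Qed.

Lemma gK y : g y <> xs -> position (g y) = y.
Proof. by move=> ys; apply/esym/g_inj => //; rewrite positionK. Qed.

Lemma measurable_point (x : BX) : measurable [set x].
Proof.
rewrite -[X in measurable X]setCK; apply: measurableC; apply: sub_sigma_algebra.
exact: open_setC1_path.
Qed.

Lemma measurable_g : measurable_fun [set: Y] (g : Y -> BX).
Proof.
apply: (@measurability _ _ Y BX setT g (@open X)) => // _ [U oU <-].
by rewrite setTI; apply: sub_sigma_algebra; move/continuousP : g_cont; exact.
Qed.

Lemma measurable_position : measurable_fun [set: BX] (position : BX -> Y).
Proof.
apply: (@measurability _ _ BX Y setT position (@open (odometer m))) => //.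
(* The preimage splits into a part of the point [xs] and the rest, which is open by [g_open]. *)
move=> _ [U oU <-]; rewrite setTI -(setUIDK (position @^-1` U) [set xs]).
apply: measurableU.
  have [|/set0P[x [Ux xsx]]] := eqVneq (position @^-1` U `&` [set xs]) set0.
    by move=> ->; exact: measurable0.
  rewrite (_ : _ `&` _ = [set xs]); first exact: measurable_point.
  by apply/seteqP; split=> [y []//|y ->]; split=> //; rewrite -xsx.
rewrite (_ : _ `\` _ = g @` U `&` [set~ xs]).
  by apply: sub_sigma_algebra; exact: g_open.
apply/seteqP; split=> x [xU xs'].
  by split=> //; exists (position x) => //; rewrite positionK.
by split=> //; case: xU xs' => y Uy <- ys; rewrite /= gK.
Qed.

Definition regular_set : set BX := g @` (~` orbit_to_0).

Lemma regularP x : regular_set x <-> x <> xs /\ ~ orbit_to_0 (position x).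
Proof.
split=> [[y yZ <-]|[xx xZ]]; last first.
  by exists (position x) => //; rewrite positionK.
by have [ys _] := g_conj yZ; rewrite gK.
Qed.

Lemma countable_irregular : countable (~` regular_set).
Proof.
pose F (b : bool) := if b then [set xs] else g @` orbit_to_0.
apply: (@sub_countable _ _ _ (\bigcup_b F b)); last first.
  apply: bigcup_countable; first exact: countableP.
  move=> [] _; first exact: countable1.
  exact: card_le_trans (card_image_le _ _) countable_orbit_to_0.
apply: subset_card_le => x xr.
have [->|/eqP xx] := eqVneq x xs; first by exists true.
exists false => //; apply: contrapT => xZ; apply: xr.
apply/regularP; split=> // xo.
by apply: xZ; exists (position x) => //; rewrite positionK.
Qed.

Lemma measurable_countable (A : set BX) : countable A -> measurable A.
Proof. exact: countable_measurable measurable_point. Qed.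

Lemma measurable_regular : measurable regular_set.
Proof.
rewrite -[regular_set]setCK; apply: measurableC; apply: measurable_countable.
exact: countable_irregular.
Qed.

Lemma preimage_T_regular (A : set BX) x : regular_set x ->
  (exists2 y, T x = Some y & A y) <-> A (g (shift (position x))).
Proof.
move=> /regularP[xx xZ]; have [_] := g_conj xZ; rewrite positionK // => ->.
by split=> [[y [<-]]|Ax]; last by exists (g (shift (position x))).
Qed.

Lemma measurable_preimage_T (A : set BX) : measurable A ->
  measurable [set x : BX | exists2 y, T x = Some y & A y].
Proof.
move=> mA; set B := [set x : BX | _].
(* On the regular set T is [g \o shift \o position]; what remains is countable, hence measurable. *)
rewrite -(setUIDK B regular_set); apply: measurableU; last first.
  apply: measurable_countable; apply: sub_countable countable_irregular.
  by apply: subset_card_le => x [].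
rewrite (_ : _ `&` _ =
    regular_set `&` ((g : Y -> BX) \o shift \o position) @^-1` A).
  apply: measurableI; first exact: measurable_regular.
  rewrite -[X in measurable X]setTI.
  apply: (measurableT_comp _ measurable_position) => //.
  apply: (measurableT_comp measurable_g).
  exact: measurable_odometer_map.
apply/seteqP; split=> x.
  by move=> [xB xr]; split=> //; exact: (preimage_T_regular A xr).1.
by move=> [xr xA]; split=> //; exact: (preimage_T_regular A xr).2.
Qed.

Lemma nonatomic_point (mu : probability BX R) (x : BX) :
  nonatomic mu -> mu [set x] = 0%E.
Proof.
move=> mu_na; apply: contrapT => /eqP mux; apply: (mu_na [set x]); split.
- exact: measurable_point.
- by rewrite lt0e mux measure_ge0.
- move=> B _ Bx; have [->|/set0P[y By]] := eqVneq B set0.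
    by left; exact: measure0.
  right; congr (mu _); apply/seteqP; split=> // _ ->.
  by rewrite -(Bx _ By).
Qed.

Lemma exists_unique_nonatomic_measure :
  exists mu : probability BX R,
    [/\ nonatomic mu /\ invariant_measure mu T,
        (forall mu' : probability BX R,
          nonatomic mu' -> invariant_measure mu' T ->
          forall A, measurable A -> mu' A = mu A) &
        exists nu : probability Y R,
          is_haar nu /\ measure_isomorphic mu T nu (@odometer_map m)].
Proof.
have [nu nuE] := exists_haar R m.
have [mu muE] := pushforward_probability nu measurable_g.
have null_Z : nu.-negligible orbit_to_0.
  apply: countable_negligible countable_orbit_to_0 => y; split.
    exact: measurable_odometer_point.
  exact: odometer_point_null.
have m_pos (B : set Y) : measurable B -> measurable (position @^-1` B : set BX).
  by move=> mB; rewrite -[X in measurable X]setTI; exact: measurable_position.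
have m_g (A : set BX) : measurable A -> measurable (g @^-1` A : set Y).
  by move=> mA; rewrite -[X in measurable X]setTI; exact: measurable_g.
have m_shift (B : set Y) : measurable B -> measurable (shift @^-1` B : set Y).
  move=> mB; rewrite -[X in measurable X]setTI.
  exact: measurable_odometer_map.
have mu_position (B : set Y) : measurable B -> mu (position @^-1` B) = nu B.
  move=> mB; rewrite muE; apply: (measure_mod_null _ mB null_Z).
    by apply: (m_g _); apply: (m_pos _).
  by move=> y yZ; have [ys _] := g_conj yZ; rewrite /preimage /= gK.
(* Choose a residue class size below the mass of a supposed atom: each class then meets it in a null
   set, so the atom itself is null. *)
have mu_na : nonatomic mu.
  move=> A [mA A_gt0 A_atom].
  have Afin : mu A \is a fin_num by apply: fin_num_measure.
  have [|i iA] := @inv_modulus_small R m (fine (mu A)).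
    by rewrite fine_gt0 // A_gt0 ltey_eq Afin.
  have : mu.-negligible A.
    have -> : A = \bigcup_c (A `&` position @^-1` (@residue_set m i c)).
      by apply/seteqP; split=> [x Ax|x [c _ []]//]; exists (position x i).
    apply: negligible_bigcup => c.
    have mC : measurable (position @^-1` (@residue_set m i c) : set BX).
      by apply: (m_pos _); apply: measurable_residue_set.
    have mAC := measurableI _ _ mA mC.
    apply/negligibleP => //; have [//|muAC] := A_atom _ mAC (@subIsetl _ _ _).
    have [ci|ci] := ltnP c (m i); last first.
      rewrite (_ : _ `&` _ = set0) ?measure0 //.
      apply/seteqP; split=> // x [_ xc]; have [+ _] := residueP (position x) i.
      by rewrite xc ltnNge ci.
    have : (mu A <= ((m i)%:R^-1)%:E)%E.
      rewrite -muAC -(nuE _ _ ci) -mu_position; last first.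
        exact: measurable_residue_set.
      by apply: le_measure; rewrite ?inE.
    by rewrite -[mu A]fineK // lee_fin leNgt iA.
  by move=> /(measure_negligible mA) A0; rewrite A0 ltxx in A_gt0.
have null_irr (P : probability BX R) :
    nonatomic P -> P.-negligible (~` regular_set).
  move=> P_na; apply: countable_negligible countable_irregular => x.
  by split; [exact: measurable_point|exact: nonatomic_point].
have TE (P : probability BX R) (A : set BX) : nonatomic P -> measurable A ->
    P [set x | exists2 y, T x = Some y & A y] =
    P (position @^-1` (shift @^-1` (g @^-1` A))).
  move=> P_na mA; apply: (measure_mod_null _ _ (null_irr P P_na)).
  - exact: measurable_preimage_T.
  - by apply: (m_pos _); apply: (m_shift _); apply: (m_g _).
  - by move=> x /contrapT /(preimage_T_regular A).
exists mu; split.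
- split=> // A mA TA; split; first exact: measurable_preimage_T.
  rewrite TE // mu_position; last by apply: (m_shift _); apply: (m_g _).
  rewrite shift_invariant //; last exact: m_g.
- move=> P P_na P_inv A mA.
  (* A competing measure is moved to the odometer, where shift invariance fixes its values on
     residue sets. *)
  have [nu' nu'E] := pushforward_probability P measurable_position.
  have nu'_inv (B : set Y) : measurable B -> nu' (shift @^-1` B) = nu' B.
    move=> mB; rewrite !nu'E; have [_ <-] := P_inv _ (m_pos _ mB).
    rewrite TE //; last exact: m_pos.
    apply: (measure_mod_null _ _ (null_irr P P_na)).
    + by apply: (m_pos _); apply: (m_shift _).
    + by apply: (m_pos _); apply: (m_shift _); apply: (m_g _); apply: (m_pos _).
    + move=> x /contrapT /regularP[_ xZ].
      by rewrite /preimage /= gK //; have [] := g_conj (shift_orbit_to_0 xZ).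
  rewrite muE; transitivity (nu' (g @^-1` A)).
    rewrite nu'E; apply: (measure_mod_null mA _ (null_irr P P_na)).
      by apply: (m_pos _); apply: (m_g _).
    by move=> x /contrapT /regularP[xx _]; rewrite /preimage /= positionK.
  apply: odometer_measure_eq; last exact: m_g.
  by move=> i c ci; rewrite nuE // shift_invariant_residue.
- exists nu; split; first exact: haar_of_residues.
  exists regular_set, (~` orbit_to_0), position, g; split.
  + have mreg := measurable_regular.
    have mZ : measurable orbit_to_0.
      apply: countable_measurable countable_orbit_to_0 => y.
      exact: measurable_odometer_point.
    split=> //; first exact: measurableC.
      by apply: measure_negligible; [exact: measurableC|exact: null_irr].
    by rewrite setCK; exact: measure_negligible.
  + split=> [x /regularP[xx xZ]|y yZ]; first by rewrite positionK.
    have [ys _] := g_conj yZ; rewrite gK //; split=> //.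
    by apply/regularP; rewrite gK.
  + split; apply: measurable_funTS; first exact: measurable_position.
    exact: measurable_g.
  + move=> B mB; rewrite -mu_position //.
    apply: (measure_mod_null _ _ (null_irr mu mu_na)).
    * apply: measurableI; [exact: measurable_regular|exact: m_pos].
    * exact: m_pos.
    * by move=> x /contrapT xr; split=> [[]|].
  + move=> x xr; have /regularP[xx xZ] := xr.
    have [_ gT] := g_conj xZ; rewrite positionK // in gT.
    exists (g (shift (position x))); have yZ := shift_orbit_to_0 xZ.
    have [ys _] := g_conj yZ.
    by split; [|apply/regularP; rewrite gK|rewrite gK].
Qed.

End almost_conjugacy.

(** * Topology of the coding *)

Section regular_diagram.
Variables (q : nat -> nat) (a : nat -> nat -> nat).
Hypothesis q_gt0 : forall n, 0 < q n.
Variables N a0 : nat.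
Hypothesis a_reg : forall n, N <= n ->
  a n (q n).-1 = 0 /\ forall i, i < (q n).-1 -> a n i = a0.
Local Notation h n := (size (block q a n)).

Lemma exists_odometer_base :
  (fun n => h n) @ \oo --> \oo ->
  exists m : odometer_base, forall i, m i = h (N + i) + a0.
Proof.
move=> block_oo; pose u i := h (N + i) + a0.
have u_gt0 i : 0 < u i by rewrite addn_gt0 block_gt0.
have u_dvd i : u i %| u i.+1.
  by rewrite /u addnS (heightS q_gt0 a_reg) ?leq_addr // dvdn_mull.
have u_oo : u @ \oo --> \oo.
  apply/cvgnyPge => k; have /cvgnyPge/(_ k)[M _ MP] := block_oo.
  exists M => // i /= Mi; rewrite /u (leq_trans (MP (N + i) _)) ?leq_addr //=.
  by rewrite (leq_trans Mi) ?leq_addl.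
by exists (OdometerBase u_gt0 u_dvd u_oo).
Qed.

Variable m : odometer_base.
Hypothesis mE : forall i, m i = h (N + i) + a0.
Local Notation X := (path_space q a).
Local Notation dec := (path_of q_gt0 a_reg mE).

Lemma continuous_path_of : continuous (dec : odometer m -> X).
Proof.
apply/continuousP => U oU; apply: odometer_openP => y Uy.
have [k kU] := open_pathP oU Uy; exists k => z zy; apply: kU.
apply: (@state_down _ _ _ _ _ (N + k).+1); first by lia.
by rewrite !state_path_of zy.
Qed.

(** At a high enough level, the path of [y] is in a tower and membership in [U] depends on the
    residue shown there; every path with the same state comes from a point with that residue. *)
Lemma open_path_of (U : set (odometer m)) : open U ->
  open (dec @` U `&` [set~ x_s q a]).
Proof.
move=> oU; apply: path_openP => _ [[y Uy <-] ys].
have [i0 yU] := open_odometerP oU Uy; have [I yI] := path_of_tower ys.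
pose i := I + i0; have yi : y i < h (N + i) by apply: yI; exact: leq_addr.
exists (N + i).+1 => x; rewrite state_path_of => xy.
have xs : x <> x_s q a.
  by move=> xs; move: xy; rewrite xs /base_state yi => /(congr1 fst).
split=> //; have [z zx] := path_of_surj q_gt0 a_reg mE xs; exists z => //.
have zy : z i = y i.
  by apply/esym/(base_state_inj yi); rewrite -xy -zx state_path_of.
have i0i : i0 <= i by exact: leq_addl.
by apply: yU; rewrite -(residue_mod_le z i0i) zy residue_mod_le.
Qed.

Lemma path_of_conj (y : odometer m) : ~ orbit_to_0 y ->
  dec y <> x_s q a /\ adic (dec y) = Some (dec (odometer_map y)).
Proof.
move=> yZ; have ys : dec y <> x_s q a by move/path_of_x_s.
by split=> //; apply: (path_of_adic ys _).1 => y0; apply: yZ; exists a0.+1.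
Qed.

(** When [a0 = 0] every residue is a position inside a block, so no point of the odometer is sent to
    [x_s] and the decoding is a homeomorphism onto the complement. *)
Lemma conjugate_on_towers : a0 = 0 ->
  conjugate_on [set~ x_s q a] (@adic_ext q a q_gt0) (@odometer_map m).
Proof.
move=> a00; have ds (y : odometer m) : dec y <> x_s q a.
  have [ylt _] := residueP y 0; rewrite mE a00 addn0 in ylt.
  move=> ys; have := state_path_of q_gt0 a_reg mE y 0.
  by rewrite ys /base_state ylt => /(congr1 fst).
have dsm (y : odometer m) : dec y \in [set~ x_s q a] by exact/mem_set/ds.
have surj (x : X) : x <> x_s q a -> exists y, dec y = x by exact: path_of_surj.
have inj y z : dec y <> x_s q a -> dec y = dec z -> y = z by exact: path_of_inj.
pose g y : [set~ x_s q a] := exist _ (dec y) (dsm y).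
pose e (x : [set~ x_s q a]) := position dec (set_val x).
have xs (x : [set~ x_s q a]) : set_val x <> x_s q a by exact: set_mem (valP x).
have gE y : set_val (g y) = dec y by [].
have decE (x : [set~ x_s q a]) : dec (e x) = set_val x.
  by apply: (positionK surj); exact: xs.
have eg : cancel g e by move=> y; rewrite /e gE (gK surj).
have ge : cancel e g by move=> x; apply: val_inj; rewrite /= decE.
exists e, g; split=> //.
- apply/continuousP => U oU; exists (dec @` U `&` [set~ x_s q a]).
    exact: open_path_of.
  apply/seteqP; split=> x.
    by move=> [[y Uy yx] _]; rewrite /preimage /= /e -yx (gK surj).
  move=> Ux; split; last exact: xs.
  by exists (e x) => //; rewrite decE.
- apply/continuousP => _ [V oV <-].
  by have /continuousP := continuous_path_of; apply.
- move=> x; exists (g (odometer_map (e x))); last by rewrite eg.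
  rewrite gE -decE /adic_ext.
  (* The point [-1] gives the maximal path, which the extension of T sends to [x_min], the path of
     0. *)
  have [y0|y0] := pselect (iter a0.+1 (@odometer_map m) (e x) = odometer0 m).
    rewrite (path_of_maximal (ds _) y0) /= -(path_of0 q_gt0 a_reg mE).
    by congr dec; rewrite -y0 a00.
  by rewrite (path_of_adic (ds _) y0).1.
Qed.

End regular_diagram.

Theorem theorem3p1 (R : realType)
    (q : nat -> nat) (a : nat -> nat -> nat) (q_gt0 : forall n, 0 < q n)
    (block_oo : (fun n => size (block q a n)) @ \oo --> \oo)
    (omega : nat -> letter)
    (omegaP : forall n, mkseq omega (size (block q a n)) = block q a n)
    (P : seq letter) (omega_P : repeats P omega)
    (P_min : forall P' : seq letter, repeats P' omega -> size P <= size P') :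
  exists N a0 : nat,
  [/\ (forall n, N <= n ->
        a n (q n).-1 = 0 /\ forall i, i < (q n).-1 -> a n i = a0),
      (forall k, 0 < k ->
        exists c, is_coding k (x_min a q_gt0) c /\ is_periodic c),
      (exists mu : probability (borel (path_space q a)) R,
        [/\ nonatomic mu /\ invariant_measure mu (@adic q a),
            (forall mu' : probability (borel (path_space q a)) R,
              nonatomic mu' -> invariant_measure mu' (@adic q a) ->
              forall A, measurable A -> mu' A = mu A) &
            exists (m : odometer_base)
              (nu : probability (borel (odometer m)) R),
              is_haar nu /\
              measure_isomorphic mu (@adic q a) nu (@odometer_map m)]) &
      (a0 = 0 ->
        exists m : odometer_base,
          conjugate_on [set~ x_s q a] (@adic_ext q a q_gt0)
            (@odometer_map m))].
Proof.
have [N [a0 a_reg]] := periodic_spacers q_gt0 block_oo omegaP omega_P P_min.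
have [m mE] := exists_odometer_base q_gt0 a_reg block_oo.
exists N, a0; split=> //.
- by move=> k _; exact: (x_min_coding_periodic q_gt0 a_reg mE).
- have [] := @exists_unique_nonatomic_measure R q a m (@adic q a)
    (path_of q_gt0 a_reg mE) (x_s q a).
  + exact: continuous_path_of.
  + by move=> x; exact: path_of_surj.
  + by move=> y z; exact: path_of_inj.
  + by move=> U; exact: open_path_of.
  + by move=> y; exact: path_of_conj.
  + by move=> mu [mu_inv mu_uniq [nu nuP]]; exists mu; split=> //; exists m, nu.
- by move=> a00; exists m; exact: (conjugate_on_towers q_gt0 a_reg mE a00).
Qed.
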